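(* Fix positive integers $t\leqslant m\leqslant n$, and let $X=(x_{ij})$ be an $m\times n$ matrix of indeterminates over a field $\mathbb{F}$ of prime characteristic $p$. Let $R=\mathbb{F}[X]$ and let $I_t\subseteq R$ be the ideal generated by the $t\times t$ minors of $X$. Then \[ \operatorname{fpt}(I_t)=\min\left\{\frac{(m-k)(n-k)}{t-k}\;\middle|\; k=0,1,\dots,t-1\right\}. \] In particular, $\operatorname{fpt}(I_t)$ does not depend on the characteristic $p$.
   Context: Let $R$ be a polynomial ring over a field of characteristic $p>0$ with homogeneous maximal ideal $\mathfrak{m}$. For $q=p^e$, $\mathfrak{m}^{[q]}$ denotes the ideal generated by $\{a^q : a\in\mathfrak{m}\}$ (equivalently, by the $q$-th powers of the variables). For a homogeneous proper ideal $I$ and $q=p^e$, set $\nu_I(q)=\max\{r\in\mathbb{N} : I^r\not\subseteq \mathfrak{m}^{[q]}\}$. The sequence $\nu_I(p^e)/p^e$ is bounded and nondecreasing, and its limit is the $F$-pure threshold $\operatorname{fpt}(I)$. *)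

(* Defs.v *)
From HB Require Import structures.
From mathcomp Require Import all_boot all_order all_algebra.
Set Implicit Arguments. Unset Strict Implicit. Unset Printing Implicit Defensive.
Import Order.TTheory GRing.Theory Num.Theory.
Local Open Scope ring_scope.

Fixpoint MP (R : comNzRingType) (k : nat) : comNzRingType :=
  match k with
  | 0 => R
  | k'.+1 => ({poly MP R k'} : comNzRingType)
  end.

(* The i-th variable (i < k) of MP R k; the outermost 'X is variable k-1. *)
Fixpoint mvar (R : comNzRingType) (k : nat) : nat -> MP R k :=
  match k return nat -> MP R k with
  | 0 => fun _ => 0
  | k'.+1 => fun i => if i == k' then ('X : {poly MP R k'})
                      else ((mvar R k' i)%:P : {poly MP R k'})
  end.

Definition ideal_gen (A : comNzRingType) (S : A -> Prop) : A -> Prop :=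
  fun x => exists (l : nat) (a s : 'I_l -> A),
      (forall i, S (s i)) /\ x = \sum_(i < l) a i * s i.

Definition ideal_mul (A : comNzRingType) (J K : A -> Prop) : A -> Prop :=
  ideal_gen (fun x => exists j k, J j /\ K k /\ x = j * k).

Fixpoint ideal_pow (A : comNzRingType) (I : A -> Prop) (r : nat) : A -> Prop :=
  match r with
  | 0 => fun _ => True
  | r'.+1 => ideal_mul (ideal_pow I r') I
  end.

Definition ideal_sub (A : comNzRingType) (J K : A -> Prop) : Prop :=
  forall x, J x -> K x.

Definition frob_pow (A : comNzRingType) (J : A -> Prop) (q : nat) : A -> Prop :=
  ideal_gen (fun x => exists a, J a /\ x = a ^+ q).

Definition polyRing (F : fieldType) (m n : nat) := MP F (m * n).

Definition genmx (F : fieldType) (m n : nat) : 'M[polyRing F m n]_(m, n) :=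
  \matrix_(i < m, j < n) mvar F (m * n) (mxvec_index i j).

Definition max_ideal (F : fieldType) (m n : nat) : polyRing F m n -> Prop :=
  ideal_gen (fun x => exists i, i < m * n /\ x = mvar F (m * n) i)%N.

Definition minors_ideal (F : fieldType) (m n t : nat) : polyRing F m n -> Prop :=
  ideal_gen (fun x => exists (f : 'I_t -> 'I_m) (g : 'I_t -> 'I_n),
     {homo f : a b / (a < b)%N >-> (a < b)%N} /\
     {homo g : a b / (a < b)%N >-> (a < b)%N} /\
     x = \det (mxsub f g (genmx F m n))).

Definition is_nu (A : comNzRingType) (I J : A -> Prop) (v : nat) : Prop :=
  ~ ideal_sub (ideal_pow I v) J /\
  (forall r, ~ ideal_sub (ideal_pow I r) J -> (r <= v)%N).

Definition rat_cvg (u : nat -> rat) (L : rat) : Prop :=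
  forall eps : rat, 0 < eps -> exists N, forall e, (N <= e)%N -> `|u e - L| < eps.

(* min_{k = 0..t-1} (m-k)(n-k)/(t-k); the k = 0 term also serves as
   the (harmless) neutral element of the fold *)
Definition fpt_formula (m n t : nat) : rat :=
  \big[Order.min/(((m * n)%N)%:R / t%:R)]_(k < t)
     ((((m - k) * (n - k))%N)%:R / ((t - k)%N)%:R).

Arguments genmx F m n : clear implicits.
Arguments max_ideal F m n : clear implicits.
Arguments minors_ideal F m n t : clear implicits.

(* Main.v *)
(* Let h_k = (m-k)(n-k), and let k minimize h_k / (t-k).

   Upper bound: translate the generic matrix by s times a diagonal idempotent of rank k,
   where s is a new scalar.  A translate of u lies in (x_ij^q) only if u does (put s = 0).
   The k x k corner of the translated matrix has determinant congruent to s^k modulo the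
   variables, so it is regular modulo (x_ij^q); after multiplication by its powers, each
   t-minor lies in the (t-k)-th power of the ideal generated by the h_k entries of the
   Schur complement, whose q-th powers lie in (x_ij^q).  Hence I_t^r is contained in
   (x_ij^q) as soon as r(t-k) > (q-1) h_k.

   Lower bound: let Delta be the product, over all diagonals of X, of the minor having that
   diagonal as its main diagonal.  Its lexicographic leading monomial is the product of all
   the variables, so Delta^(q-1) is not in (x_ij^q).  On the other hand, if the rows of a
   minor M of size a are among those of a minor M' of size b, with a < t < b, then
   M^(b-t) M'^(t-a) is integral over I_t^(b-a); this comes from Cramer's rule, which
   exchanges columns between two determinants.  Balancing the sizes of the factors of Delta
   against t by such pairs shows that Delta is integral over the power of I_t of (rational)
   exponent h_k / (t-k). *)
Require Import Defs.
From HB Require Import structures.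
From mathcomp Require Import all_boot all_order all_algebra perm boolp.
From mathcomp Require Import zify ring lra.
Import Order.TTheory GRing.Theory Num.Theory.
Local Open Scope ring_scope.
Set Implicit Arguments. Unset Strict Implicit. Unset Printing Implicit Defensive.

(** * The semiring of ideals *)

Definition is_ideal (A : comNzRingType) (J : A -> Prop) : Prop :=
  [/\ J 0, forall x y, J x -> J y -> J (x + y) & forall a x, J x -> J (a * x)].

Section IdealGen.
Variable A : comNzRingType.
Implicit Types (S T J : A -> Prop).

Lemma mem_ideal_gen S x : S x -> ideal_gen S x.
Proof.
move=> Sx; exists 1, (fun=> 1), (fun=> x); split=> //.
by rewrite big_ord1 mul1r.
Qed.

Lemma ideal_gen_min S J :
  is_ideal J -> (forall x, S x -> J x) -> ideal_sub (ideal_gen S) J.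
Proof.
move=> [J0 JD JM] SJ x [l [a [s [Ss ->]]]].
by apply: big_ind => // i _; apply/JM/SJ.
Qed.

Lemma ideal_gen_is_ideal S : is_ideal (ideal_gen S).
Proof.
split.
- by exists 0, (fun=> 0), (fun=> 0); split=> [[]//|]; rewrite big_ord0.
- move=> x y [l [a [s [Ss ->]]]] [k [b [r [Sr ->]]]].
  exists (l + k)%N, (fun i => match split i with inl j => a j | inr j => b j end),
    (fun i => match split i with inl j => s j | inr j => r j end).
  split=> [i|]; first by case: (split i).
  rewrite big_split_ord; congr (_ + _); apply: eq_bigr => i _.
    by case: split_ordP => j /eqP; rewrite ?eq_shift // => /eqP <-.
  by case: split_ordP => j /eqP; rewrite ?eq_shift // => /eqP <-.
- move=> c x [l [a [s [Ss ->]]]]; exists l, (fun i => c * a i), s; split=> //.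
  by rewrite mulr_sumr; apply: eq_bigr => i _; rewrite mulrA.
Qed.

End IdealGen.

(** Bundling makes ideals, with extensional equality, a commutative semiring, so that their powers
    and products obey the usual algebra and big operators. *)
Record ideal (A : comNzRingType) := Ideal {
  ideal_pred :> A -> Prop;
  idealP : is_ideal ideal_pred }.

HB.instance Definition _ A := gen_eqMixin (ideal A).
HB.instance Definition _ A := gen_choiceMixin (ideal A).

Section IdealSemiring.
Variable A : comNzRingType.
Implicit Types (I J K L : ideal A).

Lemma ideal0 I : I 0. Proof. by case: (idealP I). Qed.
Lemma idealD I x y : I x -> I y -> I (x + y).
Proof. by case: (idealP I) => _ + _; apply. Qed.
Lemma ideal_memMl I a x : I x -> I (a * x).
Proof. by case: (idealP I) => _ _; apply. Qed.
Lemma ideal_memMr I a x : I x -> I (x * a).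
Proof. by rewrite mulrC; apply: ideal_memMl. Qed.
Lemma idealN I x : I x -> I (- x).
Proof. by rewrite -mulN1r; apply: ideal_memMl. Qed.
Lemma idealB I x y : I x -> I y -> I (x - y).
Proof. by move=> Ix /idealN; apply: idealD. Qed.
Lemma ideal_sum I (T : Type) (r : seq T) (P : pred T) (F : T -> A) :
  (forall i, P i -> I (F i)) -> I (\sum_(i <- r | P i) F i).
Proof. by move=> IF; apply: big_ind => //; [apply: ideal0 | apply: idealD]. Qed.
Lemma ideal_subr I x y : I (x - y) -> I y -> I x.
Proof. by move=> Ixy Iy; rewrite -(subrK y x); apply: idealD. Qed.

Lemma eq_ideal I J : ideal_sub I J -> ideal_sub J I -> I = J.
Proof.
case: I J => [I hI] [J hJ] /= IJ JI; have eIJ : I = J.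
  by apply: funext => x; apply: propext; split=> [/IJ|/JI].
by subst J; rewrite (Prop_irrelevance hI hJ).
Qed.

Definition gen_ideal (S : A -> Prop) : ideal A := Ideal (ideal_gen_is_ideal S).

Definition ideal_mulI I J : ideal A :=
  gen_ideal (fun x => exists j k, I j /\ J k /\ x = j * k).

Lemma ideal_mulP I J L :
  (forall x y, I x -> J y -> L (x * y)) -> ideal_sub (ideal_mulI I J) L.
Proof.
by move=> IJL; apply: ideal_gen_min => [|_ [j [k [Ij [Jk ->]]]]]; [apply: idealP | apply: IJL].
Qed.

Lemma mem_ideal_mul I J x y : I x -> J y -> ideal_mulI I J (x * y).
Proof. by move=> Ix Jy; apply: mem_ideal_gen; exists x, y. Qed.

Lemma total_is_ideal : is_ideal (fun _ : A => True). Proof. by []. Qed.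
Definition ideal_oneI : ideal A := Ideal total_is_ideal.

Lemma zero_is_ideal : is_ideal (fun x : A => x = 0).
Proof. by split=> [//|x y -> ->|a x ->]; rewrite ?addr0 ?mulr0. Qed.
Definition ideal_zeroI : ideal A := Ideal zero_is_ideal.

Lemma add_is_ideal I J : is_ideal (fun x => exists2 i, I i & exists2 j, J j & x = i + j).
Proof.
split.
- by exists 0; [apply: ideal0 | exists 0; [apply: ideal0 | rewrite addr0]].
- move=> x y [i Ii [j Jj ->]] [i' Ii' [j' Jj' ->]].
  exists (i + i'); first exact: idealD.
  by exists (j + j'); [apply: idealD | rewrite addrACA].
- move=> a x [i Ii [j Jj ->]]; exists (a * i); first exact: ideal_memMl.
  by exists (a * j); [apply: ideal_memMl | rewrite mulrDr].
Qed.
Definition ideal_addI I J : ideal A := Ideal (add_is_ideal I J).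

Fact ideal_addA : associative ideal_addI.
Proof.
move=> I J K; apply: eq_ideal => x.
  move=> [i Ii [_ [j Jj [k Kk ->]] ->]]; rewrite addrA.
  by exists (i + j); [exists i => //; exists j | exists k].
move=> [_ [i Ii [j Jj ->]] [k Kk ->]]; rewrite -addrA.
by exists i => //; exists (j + k) => //; exists j => //; exists k.
Qed.

Fact ideal_addC : commutative ideal_addI.
Proof.
by move=> I J; apply: eq_ideal => x [i Ii [j Jj ->]]; exists j => //; exists i; rewrite 1?addrC.
Qed.

Fact ideal_add0 : left_id ideal_zeroI ideal_addI.
Proof.
move=> I; apply: eq_ideal => x; first by move=> [_ -> [j Ij ->]]; rewrite add0r.
by move=> Ix; exists 0 => //; exists x; rewrite ?add0r.
Qed.

Fact ideal_mulC : commutative ideal_mulI.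
Proof.
by move=> I J; apply: eq_ideal; apply: ideal_mulP => x y Ix Iy; rewrite mulrC;
  apply: mem_ideal_mul.
Qed.

Fact ideal_mulA : associative ideal_mulI.
Proof.
have sub I J K : ideal_sub (ideal_mulI I (ideal_mulI J K)) (ideal_mulI (ideal_mulI I J) K).
  (* For fixed [x] the elements [y] with [x * y] in the target form an ideal, so [y] may be taken to
     be a product. The reverse inclusion follows by commutativity. *)
  apply: ideal_mulP => x y Ix; have h : is_ideal (fun y => ideal_mulI (ideal_mulI I J) K (x * y)).
    split=> [|y1 y2|a y1]; rewrite ?mulr0 ?mulrDr ?(mulrCA x); first exact: ideal0.
      exact: idealD.
    exact: ideal_memMl.
  move: y; apply: (ideal_mulP (L := Ideal h)) => y z Jy Kz.
  suff : ideal_mulI (ideal_mulI I J) K (x * y * z) by rewrite -mulrA.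
  by apply: mem_ideal_mul => //; apply: mem_ideal_mul.
move=> I J K; apply: eq_ideal; first exact: sub.
by rewrite (ideal_mulC (ideal_mulI I J)) (ideal_mulC I J) (ideal_mulC I (ideal_mulI J K))
  (ideal_mulC J K); apply: sub.
Qed.

Fact ideal_mul1 : left_id ideal_oneI ideal_mulI.
Proof.
move=> I; apply: eq_ideal; first by apply: ideal_mulP => x y _; apply: ideal_memMl.
by move=> x Ix; rewrite -(mul1r x); apply: mem_ideal_mul.
Qed.

Fact ideal_mulDl : left_distributive ideal_mulI ideal_addI.
Proof.
move=> I J K; apply: eq_ideal.
  apply: ideal_mulP => _ y [i Ii [j Jj ->]] Ky; rewrite mulrDl.
  by exists (i * y); [|exists (j * y)] => //; apply: mem_ideal_mul.
move=> _ [x + [y + ->]] => IK JK; apply: idealD.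
  apply: ideal_mulP IK => {JK}u v Iu Kv; apply: mem_ideal_mul => //.
  by exists u => //; exists 0; [apply: ideal0 | rewrite addr0].
apply: ideal_mulP JK => {IK}u v Iu Kv; apply: mem_ideal_mul => //.
by exists 0; [apply: ideal0 | exists u; rewrite ?add0r].
Qed.

Fact ideal_mul0 : left_zero ideal_zeroI ideal_mulI.
Proof.
move=> I; apply: eq_ideal; first by apply: ideal_mulP => _ y -> _; rewrite mul0r.
by move=> _ ->; apply: ideal0.
Qed.

HB.instance Definition _ := GRing.isNmodule.Build (ideal A) ideal_addA ideal_addC ideal_add0.
HB.instance Definition _ := GRing.Nmodule_isComPzSemiRing.Build (ideal A)
  ideal_mulA ideal_mulC ideal_mul1 ideal_mulDl ideal_mul0.

Lemma mem_mulI I J x y : I x -> J y -> (I * J)%R (x * y).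
Proof. exact: mem_ideal_mul. Qed.

Lemma mulI_sub I J L : (forall x y, I x -> J y -> L (x * y)) -> ideal_sub (I * J)%R L.
Proof. exact: ideal_mulP. Qed.

Lemma ideal_sub_trans J I K : ideal_sub I J -> ideal_sub J K -> ideal_sub I K.
Proof. by move=> IJ JK x /IJ /JK. Qed.

Lemma mulIS I J I' J' : ideal_sub I I' -> ideal_sub J J' -> ideal_sub (I * J)%R (I' * J')%R.
Proof. by move=> II' JJ'; apply: mulI_sub => x y /II' ? /JJ'; apply: mem_mulI. Qed.

Lemma expIS I J n : ideal_sub I J -> ideal_sub (I ^+ n) (J ^+ n).
Proof. by move=> IJ; elim: n => [|n IH]; rewrite ?expr0 // !exprS; apply: mulIS. Qed.

Lemma prodIS (T : Type) (r : seq T) (P : pred T) (F G : T -> ideal A) :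
  (forall i, P i -> ideal_sub (F i) (G i)) ->
  ideal_sub (\prod_(i <- r | P i) F i) (\prod_(i <- r | P i) G i).
Proof.
move=> FG; apply: (big_ind2 (fun I J : ideal A => ideal_sub I J)) => // I I' J J'.
exact: mulIS.
Qed.

Lemma mem_expI I n x : I x -> (I ^+ n)%R (x ^+ n).
Proof. by move=> Ix; elim: n => [|n IH] //; rewrite !exprS; apply: mem_mulI. Qed.

Lemma mem_prodI (T : Type) (r : seq T) (P : pred T) (F : T -> ideal A) (f : T -> A) :
  (forall i, P i -> F i (f i)) -> (\prod_(i <- r | P i) F i)%R (\prod_(i <- r | P i) f i).
Proof. by move=> Ff; apply: (big_rec2 (fun x (I : ideal A) => I x)) => // i x I Pi; apply/mem_mulI/Ff. Qed.

Lemma expI_sub_le I m n : (m <= n)%N -> ideal_sub (I ^+ n) (I ^+ m).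
Proof.
by move=> /subnK <-; rewrite exprD; apply: mulI_sub => x y _; apply: ideal_memMl.
Qed.

Lemma expIE I n : ideal_pow I n = I ^+ n :> (A -> Prop).
Proof. by elim: n => [|n IH] //; rewrite exprSr /= IH. Qed.

Lemma colon_is_ideal L y : is_ideal (fun x => L (x * y)).
Proof.
split=> [|x1 x2|a x1]; rewrite ?mul0r ?mulrDl -1?mulrA; first exact: ideal0.
  exact: idealD.
exact: ideal_memMl.
Qed.
Definition colon L y : ideal A := Ideal (colon_is_ideal L y).

Lemma mulI_colon I J L : (forall y, J y -> ideal_sub I (colon L y)) -> ideal_sub (I * J)%R L.
Proof. by move=> h; apply: mulI_sub => x y Ix Jy; apply: h Ix. Qed.

Lemma gen_mulI_sub (P Q : A -> Prop) L : (forall x y, P x -> Q y -> L (x * y)) ->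
  ideal_sub (gen_ideal P * gen_ideal Q)%R L.
Proof.
move=> PQ; apply: mulI_colon => y Qy; apply: ideal_gen_min; first exact: idealP.
move=> x Px; suff: colon L x y by rewrite /= mulrC.
move: y Qy; apply: ideal_gen_min; first exact: idealP.
by move=> y Qy /=; rewrite mulrC; apply: PQ.
Qed.

(** Induction on [n]: passing to the colon ideal of [L] by one factor leaves a product of [n]
    generators. *)
Lemma expI_gen_sub (S : A -> Prop) n L :
  (forall s : 'I_n -> A, (forall i, S (s i)) -> L (\prod_i s i)) ->
  ideal_sub (gen_ideal S ^+ n)%R L.
Proof.
elim: n L => [|n IH] L SL.
  move=> x _; rewrite -(mulr1 x); apply: ideal_memMl.
  suff: L (\prod_(i < 0) 0) by rewrite big_ord0.
  by apply: (SL (fun=> 0)) => -[].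
rewrite exprSr; apply: mulI_colon => y Sy; apply: (IH (colon L y)) => s Ss /=; rewrite mulrC.
move: y Sy; apply: ideal_gen_min (idealP (colon L _)) _ => x Sx /=.
have := SL (fun i => oapp s x (unlift ord0 i)); rewrite big_ord_recl unlift_none /=.
under eq_bigr do rewrite liftK /=.
by apply=> i; case: unliftP => [j _|_] /=; [apply: Ss | apply: Sx].
Qed.

End IdealSemiring.

(** * Determinants *)

Section Det.
Variable A : comNzRingType.

Definition set_col k (U : 'M[A]_k) (c : 'I_k) (v : 'I_k -> A) : 'M[A]_k :=
  \matrix_(i, j) if j == c then v i else U i j.

Lemma det_set_col k (U : 'M[A]_k) c v :
  \det (set_col U c v) = \sum_i v i * cofactor U i c.
Proof.
rewrite (expand_det_col _ c); apply: eq_bigr => i _; rewrite mxE eqxx.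
congr (_ * (_ * \det _)); apply/matrixP => i' j'; rewrite !mxE.
by rewrite eq_sym (negbTE (neq_lift c j')).
Qed.

(** Cramer's rule writes [\det V] times column [c] of [U] as a combination of the columns of [V];
    [\det U] is linear in its column [c]. *)
Lemma det_exchange k (U V : 'M[A]_k) c :
  \det U * \det V = \sum_d \det (set_col U c (V^~ d)) * \det (set_col V d (U^~ c)).
Proof.
have E i : \det V * U i c = \sum_d V i d * \det (set_col V d (U^~ c)).
  have /matrixP/(_ i c) := mul_scalar_mx (\det V) U.
  rewrite -mul_mx_adj -mulmxA !mxE => <-; apply: eq_bigr => d _; congr (_ * _).
  rewrite mxE det_set_col; apply: eq_bigr => j _; by rewrite mxE mulrC.
rewrite mulrC (expand_det_col U c) mulr_sumr.
under eq_bigr do rewrite mulrA E mulr_suml.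
rewrite exchange_big /=; apply: eq_bigr => d _.
rewrite (det_set_col U) mulr_suml; apply: eq_bigr => i _.
by rewrite mulrAC.
Qed.

Lemma det_eq_cols k (U : 'M[A]_k) c d :
  c != d -> (forall i, U i c = U i d) -> \det U = 0.
Proof.
move=> cd Ucd; rewrite -det_tr; apply: (determinant_alternate cd) => i.
by rewrite !mxE Ucd.
Qed.

Lemma det_swap_rows_mem (I : ideal A) k (U : 'M[A]_k) (s : 'S_k) :
  I (\det (row_perm s U)) -> I (\det U).
Proof.
rewrite row_permE det_mulmx det_perm => IU.
by rewrite -(signrMK s (\det U)); apply: ideal_memMl.
Qed.

Lemma det_swap_cols_mem (I : ideal A) k (U : 'M[A]_k) (s : 'S_k) :
  I (\det (col_perm s U)) -> I (\det U).
Proof. by rewrite -det_tr tr_col_perm => /det_swap_rows_mem; rewrite det_tr. Qed.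

Lemma sorting_perm m t (f : 'I_t -> 'I_m) :
  injective f -> exists s : 'S_t, {homo (fun i => f (s i)) : a b / (a < b)%N >-> (a < b)%N}.
Proof.
move=> injf; pose u := [tuple f i | i < t].
have /tuple_permP[s Es] : perm_eq (sort_tuple (fun a b : 'I_m => a <= b)%N u) u.
  by rewrite perm_sort.
exists s => a b ab.
have Ei i : f (s i) = tnth (sort_tuple (fun a b : 'I_m => a <= b)%N u) i.
  by rewrite (tnth_nth (f i)) Es -tnth_nth !tnth_mktuple.
have srt : sorted (fun a b : 'I_m => a < b)%N (sort (fun a b : 'I_m => a <= b)%N u).
  rewrite -[sorted _ _]/(sorted (relpre (@nat_of_ord m) ltn) _) -sorted_map.
  rewrite ltn_sorted_uniq_leq map_inj_uniq ?sort_uniq; last exact: val_inj.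
  rewrite map_inj_uniq ?enum_uniq //= sorted_map.
  by apply: sort_sorted => x y; apply: leq_total.
rewrite !Ei !(tnth_nth (f a)) /=.
apply: (sorted_ltn_nth _ _ srt) => //; first by move=> x y z; apply: ltn_trans.
  by rewrite inE size_sort size_tuple.
by rewrite inE size_sort size_tuple.
Qed.

Lemma det_noninj_rows m n t (M : 'M[A]_(m, n)) (f : 'I_t -> 'I_m) (g : 'I_t -> 'I_n) :
  ~ injective f -> \det (mxsub f g M) = 0.
Proof.
move=> ninj; have [/injectiveP //|/injectivePn[i [j ij fij]]] := boolP (injectiveb f).
by apply: (determinant_alternate ij) => k; rewrite !mxE fij.
Qed.

(** A repeated row or column gives determinant zero, and injective choices can be sorted at the cost
    of a sign. *)
Lemma det_mxsub_mem (I : ideal A) m n t (M : 'M[A]_(m, n)) :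
  (forall (f : 'I_t -> 'I_m) (g : 'I_t -> 'I_n),
     {homo f : a b / (a < b)%N >-> (a < b)%N} ->
     {homo g : a b / (a < b)%N >-> (a < b)%N} -> I (\det (mxsub f g M))) ->
  forall (f : 'I_t -> 'I_m) (g : 'I_t -> 'I_n), I (\det (mxsub f g M)).
Proof.
move=> IM f g.
have [injf|ninj] := EM (injective f); last by rewrite det_noninj_rows //; exact: ideal0.
have [injg|ninj] := EM (injective g); last first.
  rewrite -det_tr (_ : _^T = mxsub g f M^T); last by apply/matrixP => i j; rewrite !mxE.
  by rewrite det_noninj_rows //; apply: ideal0.
have [s hs] := sorting_perm injf; have [s' hs'] := sorting_perm injg.
apply: (@det_swap_rows_mem _ _ _ s); apply: (@det_swap_cols_mem _ _ _ s').
have := IM _ _ hs hs'; congr (ideal_pred I (@determinant A t _)).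
by apply/matrixP => i j; rewrite !mxE.
Qed.

End Det.

(** * Exchange between minors *)

Section Exchange.
Variables (A : comNzRingType) (R C : Type) (X : R -> C -> A).
Variables (I : ideal A) (t : nat).
Hypothesis minorI : forall (f : 'I_t -> R) (g : 'I_t -> C),
  I (\det (\matrix_(i, j) X (f i) (g j))).

(* Laplace expansion along the columns that do not come from [X]. *)
Lemma det_cols_mem k (f : 'I_k -> R) (U : 'M[A]_k) (T : {set 'I_k}) :
  (t <= #|T|)%N -> (forall j, j \in T -> exists c, forall i, U i j = X (f i) c) -> I (\det U).
Proof.
have base (f' : 'I_t -> R) (U' : 'M[A]_t) (T' : {set 'I_t}) : (t <= #|T'|)%N ->
    (forall j, j \in T' -> exists c, forall i, U' i j = X (f' i) c) -> I (\det U').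
  move=> tT UT; have T'E : T' = [set: 'I_t].
    by apply/eqP; rewrite eqEcard subsetT cardsT card_ord.
  have /choice[g hg] : forall j, exists c, forall i, U' i j = X (f' i) c.
    by move=> j; apply: UT; rewrite T'E inE.
  by have := minorI f' g; congr (ideal_pred I (@determinant A t _)); apply/matrixP => i j; rewrite !mxE hg.
elim: k f U T => [|k IH] f U T tT UT.
  have t0 : t = 0 by apply/eqP; rewrite -leqn0 (leq_trans tT) // (leq_trans (max_card _)) // card_ord.
  by move: base tT; rewrite t0 => base tT; apply: base tT UT.
have [tk|tk] := eqVneq t k.+1.
  by move: base tT; rewrite tk => base tT; apply: base tT UT.
(* Expand along a column outside [T] if there is one; otherwise [T] has [k.+1 > t] elements and can
   lose one. *)
have [c tTc] : exists c, (t <= #|T :\ c|)%N.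
  have [TE|/forallPn[c cT]] := boolP [forall c, c \in T].
    exists ord0; have -> : T :\ ord0 = [set~ ord0].
      by apply/setP => j; rewrite !inE (forallP TE) andbT.
    rewrite cardsC1 card_ord -ltnS ltn_neqAle tk /=.
    by rewrite (leq_trans tT) // (leq_trans (max_card _)) ?card_ord.
  exists c; suff -> : T :\ c = T by [].
  by apply/setP => j; rewrite !inE; case: eqP => // ->; rewrite (negbTE cT).
rewrite (expand_det_col _ c); apply: ideal_sum => i _; do 2 apply: ideal_memMl.
apply: (IH (fun i' => f (lift i i')) _ [set j | lift c j \in T]).
  apply: leq_trans tTc _; rewrite -(card_imset _ (@lift_inj _ c)).
  apply/subset_leq_card/subsetP => j; rewrite !inE => /andP[jc jT].
  case: (unliftP c j) jc jT => [j' -> _ jT|->]; last by rewrite eqxx.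
  by apply/imsetP; exists j'; rewrite ?inE.
move=> j; rewrite inE => /UT[d hd]; exists d => i'.
by rewrite !mxE hd.
Qed.

End Exchange.

(** * Minors of different sizes, padded to full size by unit columns *)

Section Augmented.
Variables (A : comNzRingType) (C : Type) (b : nat) (Y : 'I_b -> C -> A).
Implicit Types S T : {set 'I_b}.

(* The minor of [Y] on the rows outside [S], as a determinant of full size. *)
Definition aug (S : {set 'I_b}) (g : 'I_b -> C) : 'M[A]_b :=
  \matrix_(i, j) if j \in S then (i == j)%:R else Y i (g j).

Definition aug_ideal (S : {set 'I_b}) : ideal A :=
  gen_ideal (fun x => exists g, x = \det (aug S g)).

Lemma mem_aug_ideal S g : aug_ideal S (\det (aug S g)).
Proof. by apply: mem_ideal_gen; exists g. Qed.

(** The unit column [c] of the first determinant is exchanged with each column [d] of the second. If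
    [d] is in [T], the first determinant acquires two equal unit columns and vanishes; otherwise it
    gains a column of [Y], and a transposition moves the unit column of the second from [d] to
    [c]. *)
Lemma aug_ideal_exchange S T c : T \subset S -> c \in S -> c \notin T ->
  ideal_sub (aug_ideal S * aug_ideal T)%R (aug_ideal (S :\ c) * aug_ideal (c |: T))%R.
Proof.
move=> TS cS cT; apply: gen_mulI_sub => _ _ [g ->] [h ->].
rewrite (det_exchange _ _ c); apply: ideal_sum => d _.
have [dT|dT] := boolP (d \in T).
  have cd : c != d by apply: contraNneq cT => ->.
  rewrite (det_eq_cols cd) ?mul0r; first exact: ideal0.
  by move=> i; rewrite !mxE eqxx [d == c]eq_sym (negbTE cd) (subsetP TS _ dT) dT.
apply: mem_mulI.
  apply: mem_ideal_gen; exists (fun j => if j == c then h d else g j); congr (\det _).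
  apply/matrixP => i j; rewrite !mxE !inE (negbTE dT).
  by case: eqP.
have [->|dc] := eqVneq d c.
  apply: mem_ideal_gen; exists h; congr (\det _).
  apply/matrixP => i j; rewrite !mxE !inE.
  by case: eqP => [->|//] /=; rewrite cS.
apply: (@det_swap_cols_mem _ _ _ _ (tperm c d)).
apply: mem_ideal_gen; exists (fun j => if j == d then h c else h j); congr (\det _).
apply/matrixP => i j; rewrite !mxE !inE cS.
case: tpermP => [->|->|/eqP jc /eqP jd].
- by rewrite !eqxx.
- by rewrite eq_sym (negbTE dc) !eqxx (negbTE cT) (negbTE dT).
- by rewrite (negbTE jc) (negbTE jd).
Qed.

(** Each exchange uses up one factor [aug_ideal S], releases one [aug_ideal (S :\ c)] and adds [c]
    to [T]. After [n] exchanges [T] itself is [S] minus one element. *)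
Lemma aug_ideal_chain S n T : T \subset S -> #|S :\: T| = n.+1 ->
  ideal_sub (aug_ideal S ^+ n * aug_ideal T)%R (\prod_(i in S :\: T) aug_ideal (S :\ i))%R.
Proof.
elim: n T => [|n IH] T TS cST.
  have /cards1P[i Ei] : #|S :\: T| == 1%N by rewrite cST.
  rewrite Ei big_set1 mul1r.
  suff -> : S :\ i = T by [].
  by rewrite -Ei setDDr setDv set0U; apply/setIidPr.
have [c cST'] : exists c, c \in S :\: T by apply/card_gt0P; rewrite cST.
move: (cST'); rewrite inE => /andP[cT cS].
rewrite exprSr -mulrA (big_setD1 c) //.
apply: (@ideal_sub_trans _ (aug_ideal S ^+ n * (aug_ideal (S :\ c) * aug_ideal (c |: T)))).
  by apply: mulIS => //; apply: aug_ideal_exchange.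
rewrite mulrCA; apply: mulIS => //.
have -> : S :\: T :\ c = S :\: (c |: T) by rewrite setDDl setUC.
apply: IH; first by rewrite subUset sub1set cS.
by rewrite setUC -setDDl; have := cardsD1 c (S :\: T); rewrite cST' cST => -[].
Qed.

(* A weighted form of the previous lemma: c := beta + s = #|S| copies of sets of
   size beta are traded against beta copies of [S] and s copies of the empty set. *)
Lemma aug_ideal_power (I : ideal A) beta : (0 < beta)%N ->
  (forall S : {set 'I_b}, #|S| = beta -> ideal_sub (aug_ideal S) I) ->
  forall s, exists2 K, (0 < K)%N & forall S : {set 'I_b}, #|S| = (beta + s)%N ->
    ideal_sub (aug_ideal S ^+ (beta * K) * aug_ideal set0 ^+ (s * K))%R (I ^+ ((beta + s) * K))%R.
Proof.
move=> b0 base; elim=> [|s [K K0 IH]].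
  exists 1%N => // S; rewrite addn0 => cS; rewrite mul0n mulr1 !muln1.
  exact/expIS/base.
exists ((beta + s) * K)%N => [|S cS]; first by rewrite muln_gt0 K0 addn_gt0 b0.
(* Grouped this way, [beta * K] chains produce the sets [S :\ i], of size [beta + s]. The remaining
   powers of [aug_ideal set0] supply the induction hypothesis once for every [i] in [S]. *)
have -> : aug_ideal S ^+ (beta * ((beta + s) * K)) * aug_ideal set0 ^+ (s.+1 * ((beta + s) * K)) =
    (aug_ideal S ^+ (beta + s) * aug_ideal set0) ^+ (beta * K)
      * (aug_ideal set0 ^+ (s * K)) ^+ (beta + s.+1).
  rewrite exprMn -mulrA -!exprM -exprD; congr (_ ^+ _ * _ ^+ _); nia.
apply: (@ideal_sub_trans _ ((\prod_(i in S) aug_ideal (S :\ i)) ^+ (beta * K)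
      * (aug_ideal set0 ^+ (s * K)) ^+ (beta + s.+1))).
  apply: mulIS => //; apply: expIS.
  have := @aug_ideal_chain S (beta + s) set0 (sub0set _).
  by rewrite setD0; apply; rewrite cS addnS.
rewrite -cS -prodr_const -prodrXl -big_split /=.
have -> : I ^+ (#|S| * ((beta + s) * K)) = \prod_(i in S) I ^+ ((beta + s) * K).
  by rewrite prodr_const -exprM mulnC.
apply: prodIS => i iS; apply: IH.
by have := cardsD1 i S; rewrite iS cS addnS => -[].
Qed.

End Augmented.

(** * Integrality over powers of an ideal *)

Section Integral.
Variables (A : comNzRingType) (I : ideal A).

(* A convenient strengthening of "[x] is integral over [I ^+ v]". *)
Definition integral_deg (x : A) (v : nat) : Prop :=
  exists2 N, (0 < N)%N & (I ^+ (N * v))%R (x ^+ N).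

Lemma integral_deg1 : integral_deg 1 0.
Proof. by exists 1%N. Qed.

Lemma mem_integral_deg x : I x -> integral_deg x 1.
Proof. by exists 1%N. Qed.

Lemma integral_degM x y v w :
  integral_deg x v -> integral_deg y w -> integral_deg (x * y) (v + w).
Proof.
move=> [N N0 hx] [M M0 hy]; exists (N * M)%N; first by rewrite muln_gt0 N0.
have -> : (N * M * (v + w) = N * v * M + M * w * N)%N by ring.
rewrite exprMn {2}[(N * M)%N]mulnC !exprM exprD.
apply: mem_mulI; rewrite exprM; exact: mem_expI.
Qed.

Lemma integral_degX x v n : integral_deg x v -> integral_deg (x ^+ n) (n * v).
Proof.
move=> hx; elim: n => [|n IH]; first exact: integral_deg1.
by rewrite exprS mulSn; apply: integral_degM.
Qed.

Lemma integral_deg_root x v c : (0 < c)%N -> integral_deg (x ^+ c) (c * v) -> integral_deg x v.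
Proof.
move=> c0 [N N0 hx]; exists (c * N)%N; first by rewrite muln_gt0 c0.
by rewrite (exprM x) (_ : c * N * v = N * (c * v))%N; last ring.
Qed.

Lemma integral_deg_mulr x y v : integral_deg x v -> integral_deg (x * y) v.
Proof. by move=> [N N0 hx]; exists N => //; rewrite exprMn; exact: (ideal_memMr _ hx). Qed.

Lemma integral_deg_prod (J : Type) (r : seq J) (P : pred J) (x : J -> A) (v : J -> nat) :
  (forall j, P j -> integral_deg (x j) (v j)) ->
  integral_deg (\prod_(j <- r | P j) x j) (\sum_(j <- r | P j) v j)%N.
Proof.
by move=> h; apply: (big_rec2 integral_deg) => [|j y w Pj]; [exact: integral_deg1 | exact/integral_degM/h].
Qed.

Lemma big_trichotomy (T : Type) (idx : T) (op : Monoid.com_law idx) (J : finType)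
    (s : J -> nat) t (F : J -> T) :
  \big[op/idx]_j F j = op (\big[op/idx]_(j | (s j < t)%N) F j)
    (op (\big[op/idx]_(j | (t < s j)%N) F j) (\big[op/idx]_(j | s j == t) F j)).
Proof.
rewrite (bigID (fun j => (s j < t)%N)) /= [X in op _ X](bigID (fun j => (t < s j)%N)) /=.
by congr (op _ (op _ _)); apply: eq_bigl => j; case: ltngtP.
Qed.

(* Fractional transport of the deficits [t - s i] to the surpluses [s j - t]. *)
Lemma integral_deg_balance (J : finType) (s W : J -> nat) (x : J -> A) t :
  (forall i j, (0 < W i)%N -> (0 < W j)%N -> (s i < t < s j)%N ->
     integral_deg (x i ^+ (s j - t) * x j ^+ (t - s i)) (s j - s i)) ->
  (forall j, (0 < W j)%N -> s j = t -> integral_deg (x j) 1) ->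
  (\sum_j W j * s j = t * \sum_j W j)%N ->
  integral_deg (\prod_j x j ^+ W j) (\sum_j W j)%N.
Proof.
move=> pair unit bal.
(* [D] is the total deficit; by the balance condition it is also the total surplus. *)
set D := (\sum_(i | s i < t) W i * (t - s i))%N.
have DE : D = (\sum_(j | t < s j) W j * (s j - t))%N.
  move: bal; rewrite big_distrr /= (big_trichotomy _ s t) [RHS](big_trichotomy _ s t) /=.
  have -> : (\sum_(j | s j == t) W j * s j = \sum_(j | s j == t) t * W j)%N.
    by apply: eq_bigr => j /eqP->; rewrite mulnC.
  rewrite !addnA => /addIn.
  have -> : (\sum_(i | s i < t) t * W i = \sum_(i | s i < t) W i * s i + D)%N.
    rewrite -big_split; apply: eq_bigr => i it /=; nia.
  have -> : (\sum_(j | t < s j) W j * s j = 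
     \sum_(j | t < s j) t * W j + \sum_(j | t < s j) W j * (s j - t))%N.
    rewrite -big_split; apply: eq_bigr => i it /=; nia.
  lia.
have unitW j : s j = t -> integral_deg (x j ^+ W j) (W j).
  have [->|Wj] := posnP (W j); first by move=> _; apply: integral_deg1.
  by move=> /(unit _ Wj) /(integral_degX (W j)); rewrite muln1.
have [D0|D0] := posnP D.
  apply: integral_deg_prod => j _.
  have [->|Wj] := posnP (W j); first exact: integral_deg1.
  have [sj|sj|/unitW//] := ltngtP (s j) t.
    by move: D0; rewrite /D (bigD1 j) //=; nia.
  by move: D0; rewrite DE (bigD1 j) //=; nia.
apply: (integral_deg_root D0).
(* The pair [(i, j)] is used [W i * W j] times: summing over all surpluses [j], respectively over
   all deficits [i], gives each factor the exponent [D] times its weight. *)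
have -> : (\prod_j x j ^+ W j) ^+ D =
  (\prod_(i | (s i < t)%N) \prod_(j | (t < s j)%N)
     (x i ^+ (s j - t) * x j ^+ (t - s i)) ^+ (W i * W j))
   * \prod_(j | s j == t) (x j ^+ W j) ^+ D.
  rewrite -prodrXl (big_trichotomy _ s t) /= mulrA; congr (_ * _).
  under [RHS]eq_bigr do under eq_bigr do rewrite exprMn.
  under [RHS]eq_bigr do rewrite big_split.
  rewrite big_split; congr (_ * _).
    apply: eq_bigr => i _; rewrite DE -exprM big_distrr /= -prodrXr; apply: eq_bigr => j _.
    by rewrite -exprM; congr (_ ^+ _); ring.
  rewrite exchange_big /=; apply: eq_bigr => i _; rewrite /D -exprM big_distrr /= -prodrXr.
  by apply: eq_bigr => j _; rewrite -exprM; congr (_ ^+ _); ring.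
have -> : (D * \sum_j W j =
  (\sum_(i | s i < t) \sum_(j | t < s j) (W i * W j) * (s j - s i))
   + \sum_(j | s j == t) D * W j)%N.
  rewrite (big_trichotomy _ s t) /= !mulnDr addnA; congr (_ + _)%N; last by rewrite big_distrr.
  rewrite [X in (X + _)%N]big_distrr [X in (_ + X)%N]big_distrr /=.
  under eq_bigr do rewrite DE mulnC big_distrr /=.
  rewrite {1}/D; under [X in (_ + X)%N]eq_bigr do rewrite mulnC big_distrr /=.
  rewrite [X in (_ + X)%N]exchange_big -big_split; apply: eq_bigr => i si /=.
  rewrite -big_split; apply: eq_bigr => j sj /=; nia.
apply: integral_degM; last first.
  by apply: integral_deg_prod => j /eqP /unitW; apply: integral_degX.
apply: integral_deg_prod => i si; apply: integral_deg_prod => j sj.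
have [->|Wi] := posnP (W i); first exact: integral_deg1.
have [->|Wj] := posnP (W j); first by rewrite muln0; exact: integral_deg1.
by apply: integral_degX; apply: pair; rewrite ?si.
Qed.

End Integral.

(** * Pairs of minors *)

Section Pairs.
Variables (A : comNzRingType) (X : nat -> nat -> A) (I : ideal A) (t : nat).
Hypothesis minorI : forall f g : 'I_t -> nat, I (\det (\matrix_(i, j) X (f i) (g j))).

Definition minor r c s : A := \det (\matrix_(i < s, j < s) X (r + i) (c + j)).

Lemma minor_integral r c : integral_deg I (minor r c t) 1.
Proof. exact/mem_integral_deg/minorI. Qed.

(** [aug_ideal_power] applies with [beta = b - t] and [s = t - (b - #|S|)], whose sum is [#|S|]:
    removing [b - t] rows leaves minors of size [t], which lie in [I]. *)
Lemma aug_integral r c b (S : {set 'I_b}) g : (b - #|S| < t < b)%N ->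
  integral_deg I (\det (aug (fun i => X (r + i)) S g) ^+ (b - t) * minor r c b ^+ (t - (b - #|S|)))
    #|S|.
Proof.
move=> /andP[St tb]; have cSb : (#|S| <= b)%N by have := max_card (mem S); rewrite card_ord.
have bt : (0 < b - t)%N by rewrite subn_gt0.
have [T cT|K K0] := @aug_ideal_power A nat b (fun i => X (r + i)) I _ bt _ (t - (b - #|S|)).
  apply: ideal_gen_min; [exact: idealP | move=> _ [h ->]].
  apply: (det_cols_mem minorI (f := fun i : 'I_b => (r + i)%N) (T := ~: T)).
    by rewrite cardsCs setCK card_ord cT; lia.
  by move=> j; rewrite inE => /negbTE jT; exists (h j) => i; rewrite mxE jT.
have ES : (b - t + (t - (b - #|S|)) = #|S|)%N by lia.
move=> /(_ S (esym ES)); rewrite ES => h; exists K => //.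
rewrite exprMn -!exprM mulnC; apply: h; apply: mem_mulI; apply: mem_expI; first exact: mem_aug_ideal.
apply: mem_ideal_gen; exists (fun j => c + j)%N; congr (\det _).
by apply/matrixP => i j; rewrite !mxE inE.
Qed.

(** Both minors start in row [r]. Padding the small one by the last [b - a] unit columns gives a
    block lower triangular matrix with the same determinant. *)
Lemma minor_pair_top r c1 c2 a b : (a < t < b)%N ->
  integral_deg I (minor r c1 a ^+ (b - t) * minor r c2 b ^+ (t - a)) (b - a).
Proof.
move=> /andP[at_ tb]; have [k Ek] : exists k, b = (a + k)%N by exists (b - a)%N; lia.
subst b; pose S := [set rshift a j | j in 'I_k].
have cS : #|S| = k by rewrite card_imset ?card_ord //; apply: rshift_inj.
have := @aug_integral r c2 (a + k)%N S (fun j => c1 + j)%N; rewrite cS addnK addKn.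
have -> : \det (aug (fun i : 'I_(a + k) => X (r + i)) S (fun j => c1 + j)%N) = minor r c1 a.
  rewrite /minor -[RHS]mulr1 -(det1 A k).
  rewrite -(det_lblock _ (\matrix_(i, j) X (r + (a + i)) (c1 + j))); congr (\det _).
  apply/matrixP => i j; rewrite [LHS]mxE.
  case: (split_ordP j) => j' ->.
    rewrite (_ : lshift k j' \in S = false); last first.
      by apply/imsetP => -[j2 _ /eqP]; rewrite eq_lrshift.
    by case: (split_ordP i) => i' ->; rewrite ?block_mxEul ?block_mxEdl !mxE.
  rewrite (_ : rshift a j' \in S); last by apply/imsetP; exists j'.
  by case: (split_ordP i) => i' ->; rewrite ?block_mxEur ?block_mxEdr !mxE ?eq_lrshift ?eq_shift.
by apply; lia.
Qed.

(** Both minors end in the same row, so the unit columns come first and the padded matrix is block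
    upper triangular. *)
Lemma minor_pair_bottom r c1 c2 a b : (a < t < b)%N ->
  integral_deg I (minor (r + (b - a)) c1 a ^+ (b - t) * minor r c2 b ^+ (t - a)) (b - a).
Proof.
move=> /andP[at_ tb]; have [k Ek] : exists k, b = (k + a)%N by exists (b - a)%N; lia.
subst b; pose S := [set lshift a j | j in 'I_k].
have cS : #|S| = k by rewrite card_imset ?card_ord //; apply: lshift_inj.
have := @aug_integral r c2 (k + a)%N S (fun j => c1 + (j - k))%N; rewrite cS addnK addKn.
have -> : \det (aug (fun i : 'I_(k + a) => X (r + i)) S (fun j => c1 + (j - k))%N) =
    minor (r + k) c1 a.
  rewrite /minor -[RHS]mul1r -(det1 A k).
  rewrite -(det_ublock _ (\matrix_(i, j) X (r + i) (c1 + j))); congr (\det _).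
  apply/matrixP => i j; rewrite [LHS]mxE.
  case: (split_ordP j) => j' ->.
    rewrite (_ : lshift a j' \in S); last by apply/imsetP; exists j'.
    by case: (split_ordP i) => i' ->; rewrite ?block_mxEul ?block_mxEdl !mxE ?eq_rlshift ?eq_shift.
  rewrite (_ : rshift k j' \in S = false); last first.
    by apply/imsetP => -[j2 _ /eqP]; rewrite eq_rlshift.
  by case: (split_ordP i) => i' ->; rewrite ?block_mxEur ?block_mxEdr !mxE /= addKn -?addnA.
by apply; lia.
Qed.

End Pairs.

(** * Iterated polynomial rings *)

Section MPoly.
Variable R : comNzRingType.

Fixpoint mconst k : R -> MP R k :=
  match k return R -> MP R k with
  | 0 => id
  | k'.+1 => fun c => ((mconst k' c)%:P : {poly MP R k'})
  end.

(** Used with [q = p ^ e], where over a field it is the Frobenius power of the maximal ideal, and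
    with [q = 1], the ideal of the variables. *)
Definition varpow_ideal q k : ideal (MP R k) :=
  gen_ideal (fun x => exists i, (i < k)%N /\ x = mvar R k i ^+ q).

Lemma mvar_top k : mvar R k.+1 k = ('X : {poly MP R k}).
Proof. by rewrite /= eqxx. Qed.

Lemma mvar_low k i : (i < k)%N -> mvar R k.+1 i = ((mvar R k i)%:P : {poly MP R k}).
Proof. by move=> ik /=; rewrite ltn_eqF. Qed.

(* Coefficientwise description of [varpow_ideal q k]: no monomial with all
   exponents below [q] occurs. *)
Fixpoint no_small q k : MP R k -> Prop :=
  match k return MP R k -> Prop with
  | 0 => fun x => x = 0
  | k'.+1 => fun f : {poly MP R k'} => forall j, (j < q)%N -> no_small q f`_j
  end.

Lemma no_small_is_ideal q k : is_ideal (@no_small q k).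
Proof.
elim: k => [|k [IH0 IHD IHM]] /=.
  by split=> [//|x y -> ->|a x ->]; rewrite ?addr0 ?mulr0.
split=> [j _|f g Hf Hg j jq|a f Hf j jq]; first by rewrite coef0.
  by rewrite coefD; apply: IHD; [apply: Hf | apply: Hg].
rewrite coefM; apply: big_ind => // i _.
by apply/IHM/Hf; apply: leq_ltn_trans (leq_subr _ _) jq.
Qed.

Lemma varpow_no_small q k : ideal_sub (varpow_ideal q k) (@no_small q k).
Proof.
apply: ideal_gen_min; first exact: no_small_is_ideal.
move=> _ [i [ik ->]]; elim: k ik => // k IH; rewrite ltnS leq_eqVlt => /predU1P[->|ik].
  rewrite mvar_top => j jq; rewrite coefXn ltn_eqF //.
  by case: (no_small_is_ideal q k).
rewrite mvar_low // -polyC_exp => j jq; rewrite coefC.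
by case: eqP => _; [apply: IH | case: (no_small_is_ideal q k)].
Qed.

Lemma no_small_varpow q k : ideal_sub (@no_small q k) (varpow_ideal q k).
Proof.
elim: k => [|k IH] f; first by move=> ->; apply: ideal0.
move=> Hf; rewrite -[f]coefK poly_def; apply: ideal_sum => j _.
rewrite -mul_polyC; have [jq|qj] := ltnP j q.
  apply: ideal_memMr; move: (IH _ (Hf _ jq)); move: (f`_j).
  have h : is_ideal (fun c => varpow_ideal q k.+1 (c%:P : {poly MP R k})).
    split=> [|x y|a x]; rewrite ?polyC0 ?polyCD ?polyCM; first exact: ideal0.
      exact: idealD.
    exact: ideal_memMl.
  apply: (ideal_gen_min h) => _ [i [ik ->]]; apply: mem_ideal_gen.
  by exists i; rewrite ltnS ltnW // mvar_low // polyC_exp.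
apply: ideal_memMl; rewrite -(subnK qj) exprD; apply: ideal_memMl.
by apply: mem_ideal_gen; exists k; rewrite mvar_top.
Qed.

(** Membership is tested coefficientwise by [no_small], and a constant multiplies every coefficient
    by [c]. *)
Lemma varpow_regular q k c f : GRing.lreg c ->
  varpow_ideal q k (mconst k c * f) -> varpow_ideal q k f.
Proof.
move=> creg /varpow_no_small H; apply: no_small_varpow.
elim: k f H => [|k IH] f /= H; first by apply: creg; rewrite mulr0.
by move=> j jq; apply: IH; rewrite -coefCM; apply: H.
Qed.

Lemma pchar_MP p k : p \in [pchar R] -> p \in [pchar MP R k].
Proof. by move=> pR; elim: k => [//|k IH]; exact: (rmorph_pchar (@polyC (MP R k))). Qed.

Lemma mconstX k c n : mconst k (c ^+ n) = mconst k c ^+ n.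
Proof. by elim: k => [//|k IH] /=; rewrite IH polyC_exp. Qed.

(** Existence in the universal property of polynomial rings, one variable at a time by evaluation;
    uniqueness is [MP_hom_eq]. *)
Lemma MP_hom (A : comNzRingType) (phi : {rmorphism R -> A}) (v : nat -> A) k :
  exists psi : {rmorphism MP R k -> A},
    (forall i, (i < k)%N -> psi (mvar R k i) = v i) /\ (forall c, psi (mconst k c) = phi c).
Proof.
elim: k => [|k [psi [psiv psic]]]; first by exists phi.
have cv : commr_rmorph psi (v k) by move=> x; apply: mulrC.
exists (horner_morph cv : {rmorphism {poly MP R k} -> A}); split=> [i|c].
  rewrite ltnS leq_eqVlt => /predU1P[->|ik]; first by rewrite mvar_top; exact: (horner_morphX cv).
  by rewrite mvar_low //; apply: etrans (horner_morphC cv _) (psiv i ik).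
exact: etrans (horner_morphC cv _) (psic c).
Qed.

Lemma MP_hom_eq (A : comNzRingType) k (psi1 psi2 : {rmorphism MP R k -> A}) :
  (forall i, (i < k)%N -> psi1 (mvar R k i) = psi2 (mvar R k i)) ->
  (forall c, psi1 (mconst k c) = psi2 (mconst k c)) -> psi1 =1 psi2.
Proof.
elim: k psi1 psi2 => [|k IH] psi1 psi2 Hv Hc f; first exact: Hc.
have E : psi1 \o (@polyC (MP R k)) =1 psi2 \o (@polyC (MP R k)).
  apply: IH => [i ik|c] /=; last exact: (Hc c).
  by have := Hv i (ltnW ik); rewrite mvar_low.
have := Hv k (ltnSn k); rewrite mvar_top => HX.
rewrite -[f]coefK poly_def !rmorph_sum; apply: eq_bigr => j _.
rewrite -mul_polyC !rmorphM !rmorphXn; congr (_ * _ ^+ _); last exact: HX.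
exact: E.
Qed.

(* The lexicographically largest monomial of [f], for the order in which the
   variables of largest index dominate, is [prod_i x_i ^ (e i)], with coefficient 1. *)
Fixpoint lead_mon k : MP R k -> (nat -> nat) -> Prop :=
  match k return MP R k -> (nat -> nat) -> Prop with
  | 0 => fun f _ => f = 1
  | k'.+1 => fun (f : {poly MP R k'}) e => size f = (e k').+1 /\ lead_mon (lead_coef f) e
  end.

Lemma lead_mon_ext k (f : MP R k) e e' :
  (forall i, (i < k)%N -> e i = e' i) -> lead_mon f e -> lead_mon f e'.
Proof.
elim: k f => [//|k IH] f ee' [sf lf]; split; first by rewrite -ee'.
by apply: IH lf => i ik; apply/ee'/ltnW.
Qed.

Lemma lead_mon_neq0 k (f : MP R k) e : lead_mon f e -> f != 0.
Proof. by case: k f => [|k] f; [move=> ->; apply: oner_neq0 | move=> [sf _]; rewrite -size_poly_gt0 sf]. Qed.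

Lemma lead_mon1 k : lead_mon (1 : MP R k) (fun=> 0%N).
Proof.
elim: k => [//|k IH]; split; first by rewrite size_poly1.
by rewrite lead_coef1.
Qed.

(** Degrees add because the product of the leading coefficients has, by induction, a leading
    monomial and is therefore nonzero. *)
Lemma lead_monM k (f g : MP R k) e e' :
  lead_mon f e -> lead_mon g e' -> lead_mon (f * g) (fun i => e i + e' i)%N.
Proof.
elim: k f g => [|k IH] f g; first by move=> -> ->; apply: mulr1.
move=> [sf lf] [sg lg]; have lfg := IH _ _ lf lg.
have nz := lead_mon_neq0 lfg.
by split; [rewrite size_proper_mul // sf sg addSn addnS | rewrite lead_coef_proper_mul].
Qed.

Lemma lead_monX k (f : MP R k) e n : lead_mon f e -> lead_mon (f ^+ n) (fun i => n * e i)%N.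
Proof.
move=> lf; elim: n => [|n IH]; first exact: lead_mon1.
by rewrite exprS; apply: lead_mon_ext (lead_monM lf IH) => i _; rewrite mulSn.
Qed.

Lemma lead_mon_prod k (J : finType) (f : J -> MP R k) (e : J -> nat -> nat) :
  (forall j, lead_mon (f j) (e j)) -> lead_mon (\prod_j f j) (fun i => \sum_j e j i)%N.
Proof.
move=> lf; elim: (index_enum J) => [|j r IH].
  by rewrite big_nil; apply: lead_mon_ext (lead_mon1 k) => i _; rewrite big_nil.
rewrite big_cons; apply: lead_mon_ext (lead_monM (lf j) IH) => i _.
by rewrite big_cons.
Qed.

(** The leading monomial has coefficient 1, while [no_small] would force this coefficient to be
    0. *)
Lemma lead_mon_notin q k (f : MP R k) e :
  lead_mon f e -> (forall i, (i < k)%N -> (e i < q)%N) -> ~ varpow_ideal q k f.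
Proof.
move=> lf eq /varpow_no_small; elim: k f lf eq => [|k IH] f.
  by move=> -> _ /eqP; rewrite oner_eq0.
move=> [sf lf] eq /(_ _ (eq k (ltnSn k))) H; apply: IH (lf) _ _.
  by move=> i ik; apply/eq/ltnW.
by rewrite lead_coefE sf.
Qed.

(** Only variables of index less than [v] occur, so any monomial containing the variable [v] and
    otherwise only such variables dominates those of [f]. *)
Fixpoint below v k : MP R k -> Prop :=
  match k return MP R k -> Prop with
  | 0 => fun _ => True
  | k'.+1 => fun f : {poly MP R k'} =>
      ((v <= k')%N -> (size f <= 1)%N) /\ forall j, below v f`_j
  end.

Lemma belowC v k (c : MP R k) : below v c -> @below v k.+1 (c%:P : {poly MP R k}).
Proof.
move=> bc; split=> [_|j]; first exact: size_polyC_leq1.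
rewrite coefC; case: eqP => // _; elim: (k) => [//|k' IH]; split=> [_|i].
  by rewrite size_poly0.
by rewrite coef0.
Qed.

Lemma below0 v k : below v (0 : MP R k).
Proof. by elim: k => [//|k IH]; rewrite -[0]polyC0; apply: belowC. Qed.

Lemma below1 v k : below v (1 : MP R k).
Proof. by elim: k => [//|k IH]; rewrite -[1]polyC1; apply: belowC. Qed.

Lemma belowD v k (f g : MP R k) : below v f -> below v g -> below v (f + g).
Proof.
elim: k f g => [//|k IH] f g [sf bf] [sg bg]; split=> [vk|j].
  by rewrite (leq_trans (size_polyD _ _)) // geq_max sf ?sg.
by rewrite coefD; apply: IH; [apply: bf | apply: bg].
Qed.

Lemma below_sum v k (J : Type) (r : seq J) (P : pred J) (f : J -> MP R k) :
  (forall j, P j -> below v (f j)) -> below v (\sum_(j <- r | P j) f j).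
Proof. by move=> bf; apply: big_ind => //; [apply: below0 | apply: belowD]. Qed.

Lemma belowM v k (f g : MP R k) : below v f -> below v g -> below v (f * g).
Proof.
elim: k f g => [//|k IH] f g [sf bf] [sg bg]; split=> [vk|j].
  rewrite (leq_trans (size_polyMleq _ _)) //.
  by have := sf vk; have := sg vk; case: (size f) => [|[]]; case: (size g) => [|[]].
by rewrite coefM; apply: below_sum => i _; apply: IH; [apply: bf | apply: bg].
Qed.

Lemma below_opp1 v k : below v (-1 : MP R k).
Proof. by elim: k => [//|k IH]; rewrite -[1]polyC1 -polyCN; apply: belowC. Qed.

Lemma below_sign v k (n : nat) : below v ((-1) ^+ n : MP R k).
Proof.
elim: n => [|n IH]; first exact: below1.
by rewrite exprS; apply: belowM => //; apply: below_opp1.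
Qed.

Lemma below_det v k t (U : 'M[MP R k]_t) : (forall i j, below v (U i j)) -> below v (\det U).
Proof.
move=> bU; apply: below_sum => s _; apply: belowM; first exact: below_sign.
by apply: big_ind => //; [apply: below1 | apply: belowM].
Qed.

Lemma below_mvar v k i : (i < v)%N -> below v (mvar R k i).
Proof.
move=> iv; elim: k => [//|k IH] /=; case: eqP => [ik|_]; last exact: belowC.
split=> [vk|j]; first by move: iv; rewrite ik ltnNge vk.
by rewrite coefX; case: eqP => _; [apply: below1 | apply: below0].
Qed.

Lemma lead_mon_mvarMD v k (d r : MP R k) e : (v < k)%N -> below v d -> below v r ->
  lead_mon d e -> lead_mon (mvar R k v * d + r) (fun i => e i + (i == v))%N.
Proof.
elim: k d r => [//|k IH] d r; rewrite ltnS => vk [sd bd] [sr br] [sde ld].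
have ek : e k = 0%N by apply/eqP; rewrite -leqn0 -ltnS -sde; apply: sd.
have dE : d = (d`_0)%:P by apply: size1_polyC; apply: sd.
have rE : r = (r`_0)%:P by apply: size1_polyC; apply: sr.
have ld0 : lead_mon d`_0 e by move: ld; rewrite lead_coefE sde ek.
have nz := lead_mon_neq0 ld0.
(* If [v] is the outermost variable, the polynomial has degree 1 and leading coefficient [d];
   otherwise it is constant in that variable and the induction applies. *)
move: vk; rewrite leq_eqVlt => /predU1P[->|vk].
  rewrite mvar_top rE dE.
  have sE : size ('X * (d`_0)%:P + (r`_0)%:P : {poly MP R k}) = 2.
    by rewrite mulrC size_MXaddC size_polyC polyC_eq0 (negbTE nz).
  split; first by rewrite ek eqxx.
  rewrite lead_coefE sE /= coefD coefXM !coefC /= addr0.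
  by apply: lead_mon_ext ld0 => i ik; rewrite ltn_eqF // addn0.
have L := IH _ _ vk (bd 0%N) (br 0%N) ld0.
rewrite mvar_low // rE dE -polyCM -polyCD.
split; last by rewrite lead_coefC.
by rewrite size_polyC (lead_mon_neq0 L) ek gtn_eqF.
Qed.

End MPoly.

(** * Ideals and the Frobenius map *)

Lemma pcharf_exp_nat (A : comNzRingType) (p e : nat) : p \in [pchar A] -> [pchar A].-nat (p ^ e)%N.
Proof.
move=> pA; rewrite pnatX; apply/orP; left.
by rewrite pnatE ?(pcharf_prime pA).
Qed.

Section Frobenius.
Variables (A : comNzRingType) (p e : nat).
Hypothesis pA : p \in [pchar A].

Lemma frobD (x y : A) : (x + y) ^+ (p ^ e) = x ^+ (p ^ e) + y ^+ (p ^ e).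
Proof. by apply: exprDn_pchar; apply: pcharf_exp_nat. Qed.

Lemma frob_preimage_is_ideal (L : ideal A) : is_ideal (fun x => L (x ^+ (p ^ e))).
Proof.
split=> [|x y|a x]; rewrite ?frobD ?exprMn; last exact: ideal_memMl.
  rewrite expr0n expn_eq0 eqn0Ngt prime_gt0 ?(pcharf_prime pA) //; exact: ideal0.
exact: idealD.
Qed.

(** The preimage of an ideal under the additive map $x \mapsto x^{p^e}$ is an ideal, so checking
    generators suffices. *)
Lemma ideal_gen_frob (S : A -> Prop) (L : ideal A) x :
  (forall s, S s -> L (s ^+ (p ^ e))) -> ideal_gen S x -> L (x ^+ (p ^ e)).
Proof. by move=> SL; apply: ideal_gen_min (frob_preimage_is_ideal L) SL x. Qed.

End Frobenius.

(** * The generic matrix *)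

Lemma index_allpairs_pair (T1 T2 : eqType) (s1 : seq T1) (s2 : seq T2) x y :
  x \in s1 -> y \in s2 ->
  index (x, y) [seq (a, b) | a <- s1, b <- s2] = (index x s1 * size s2 + index y s2)%N.
Proof.
move=> + ys; elim: s1 => // a s1 IH; rewrite inE allpairs_cons index_cat /= => xs.
have [<-|ax] := eqVneq a x.
  by rewrite mem_map ?ys ?index_map // => ? ? [].
rewrite ifF; last by apply/mapP => -[b _ [E _]]; rewrite E eqxx in ax.
by rewrite IH ?size_map ?mulSn ?addnA //; move: xs; rewrite eq_sym (negbTE ax).
Qed.

(** Makes the row by row numbering of the variables explicit; leading monomials of minors are
    computed in it. *)
Lemma mxvec_indexE m n (i : 'I_m) (j : 'I_n) : mxvec_index i j = (i * n + j)%N :> nat.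
Proof.
have lt_ij : (enum_rank (i, j) < size (enum {: 'I_m * 'I_n}))%N by rewrite -cardE ltn_ord.
rewrite -[LHS](index_uniq (i, j) lt_ij (enum_uniq _)).
rewrite nth_enum_rank enumT unlock /= /prod_enum.
by rewrite index_allpairs_pair ?mem_enum // !index_enum_ord size_enum_ord.
Qed.

(* Indices range over [nat]; out-of-range entries are junk and set to zero. *)
Definition gx (R : comNzRingType) (m n i j : nat) : MP R (m * n) :=
  if (i < m)%N && (j < n)%N then mvar R (m * n) (i * n + j) else 0.

Lemma gxE (F : fieldType) m n (i : 'I_m) (j : 'I_n) : gx F m n i j = Defs.genmx F m n i j.
Proof. by rewrite /gx !ltn_ord /= mxE mxvec_indexE. Qed.

Definition minorsI (F : fieldType) m n t : ideal (polyRing F m n) :=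
  gen_ideal (fun x => exists (f : 'I_t -> 'I_m) (g : 'I_t -> 'I_n),
     {homo f : a b / (a < b)%N >-> (a < b)%N} /\
     {homo g : a b / (a < b)%N >-> (a < b)%N} /\
     x = \det (mxsub f g (Defs.genmx F m n))).

Lemma det_out_rows (A : comNzRingType) t (U : 'M[A]_t) (i : 'I_t) :
  (forall j, U i j = 0) -> \det U = 0.
Proof. by move=> U0; rewrite (expand_det_row _ i) big1 // => j _; rewrite U0 mul0r. Qed.

Lemma minorsI_mem (F : fieldType) m n t (f g : 'I_t -> nat) :
  minorsI F m n t (\det (\matrix_(i, j) gx F m n (f i) (g j))).
Proof.
have [/forallP fm|/forallPn[i fi]] := boolP [forall i, (f i < m)%N]; last first.
  rewrite (det_out_rows (i := i)); first exact: ideal0.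
  by move=> j; rewrite mxE /gx (negbTE fi).
have [/forallP gn|/forallPn[i gi]] := boolP [forall i, (g i < n)%N]; last first.
  rewrite -det_tr (det_out_rows (i := i)); first exact: ideal0.
  by move=> j; rewrite !mxE /gx (negbTE gi) andbF.
have := @det_mxsub_mem _ (minorsI F m n t) m n t (Defs.genmx F m n) _
  (fun i => Ordinal (fm i)) (fun j => Ordinal (gn j)).
rewrite (_ : mxsub _ _ _ = \matrix_(i, j) gx F m n (f i) (g j)).
  by apply=> f' g' hf hg; apply: mem_ideal_gen; exists f', g'.
by apply/matrixP => i j; rewrite [LHS]mxE -gxE [RHS]mxE.
Qed.

(** * Upper bound *)

Section Perturbation.
Variables (A : comNzRingType) (Q : ideal A).

(* The term [P *m N] has rank at most [k], so all but [k] of the rows must be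
   chosen in [V] when expanding. *)
Lemma det_low_rank_mem k t (P : 'M[A]_(t, k)) (N : 'M[A]_(k, t)) (V : 'M[A]_t) :
  (forall i j, Q (V i j)) -> (Q ^+ (t - k))%R (\det (P *m N + V)).
Proof.
move=> QV.
have -> : \det (P *m N + V) = \det (block_mx 1%:M (- N) P V).
  have -> : block_mx 1%:M (- N) P V = block_mx 1%:M 0 P 1%:M *m block_mx 1%:M (- N) 0 (P *m N + V).
    by rewrite mulmx_block !mul1mx !mul0mx !mulmx1 !addr0 mulmxN addKr.
  by rewrite det_mulmx det_lblock det_ublock !det1 !mul1r.
apply: ideal_sum => s _; apply: ideal_memMl; rewrite big_split_ord; apply: ideal_memMl => /=.
(* [B] collects the lower rows in which the permutation picks an entry of [V]; at most [k] lower
   rows can pick one of the first [k] columns. *)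
pose B := [set i : 'I_t | (k <= s (rshift k i))%N].
have cB : (t - k <= #|B|)%N.
  rewrite leq_subLR -{1}(card_ord t) -(cardsC B) addnC leq_add2r.
  have inj : {in ~: B &, injective (fun i => s (rshift k i))}.
    by move=> i j _ _ /perm_inj /rshift_inj.
  rewrite -(card_in_imset inj) -[X in (_ <= X)%N](card_ord k).
  rewrite -(card_imset predT (@lshift_inj k t)).
  apply/subset_leq_card/subsetP => _ /imsetP[i iB ->].
  move: iB; rewrite !inE -ltnNge => sk.
  by apply/imsetP; exists (Ordinal sk) => //; apply: val_inj.
apply: expI_sub_le cB _ _.
rewrite -prodr_const [X in ideal_pred X _]big_mkcond.
apply: mem_prodI => i _; rewrite inE; case: leqP => // ks.
case: (split_ordP (s (rshift k i))) ks => j -> /=; first by rewrite leqNgt ltn_ord.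
by rewrite block_mxEdr.
Qed.

(** Among more than $|J|(q-1)$ factors taken from the [w u], some [w u] occurs at least [q]
    times. *)
Lemma ideal_pigeonhole (J : finType) (w : J -> A) (L : ideal A) q N : (0 < q)%N ->
  (forall u, L (w u ^+ q)) -> (#|J| * q.-1 < N)%N ->
  ideal_sub (gen_ideal (fun x => exists u, x = w u) ^+ N)%R L.
Proof.
move=> q0 Lw JN; apply: expI_gen_sub => s /choice[phi sE].
have [u qu] : exists u, (q <= #|[pred i | phi i == u]|)%N.
  apply: contrapT => none; move: JN; rewrite ltnNge -[X in (X <= _)%N](card_ord N) => /negP; apply.
  rewrite -sum1_card (partition_big phi predT) //= -[#|J|]/#|predT| -sum_nat_const.
  apply: leq_sum => u _; rewrite sum1_card -ltnS prednK // ltnNge.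
  by apply/negP => qu; apply: none; exists u.
rewrite (bigID [pred i | phi i == u]) /=; apply: ideal_memMr.
rewrite (eq_bigr (fun=> w u)); last by move=> i /eqP <-; apply: sE.
by rewrite prodr_const -(subnK qu) exprD; apply: ideal_memMl.
Qed.

Lemma det_congr t (U V : 'M[A]_t) : (forall i j, Q (U i j - V i j)) -> Q (\det U - \det V).
Proof.
move=> UV; rewrite -sumrB; apply: ideal_sum => s _; rewrite -mulrBr; apply: ideal_memMl.
apply: (big_ind2 (fun x y => Q (x - y))) => //; first by rewrite subrr; apply: ideal0.
move=> x1 x2 y1 y2 Q1 Q2; rewrite (_ : _ - _ = (x1 - x2) * y1 + x2 * (y1 - y2)); last by ring.
by apply: idealD; [apply: ideal_memMr | apply: ideal_memMl].
Qed.

End Perturbation.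

(** * The Schur complement of the upper left corner *)

Section Corner.
Variables (A : comNzRingType) (x : nat -> nat -> A) (k : nat).

Definition corner : 'M[A]_k := \matrix_(i, j) x i j.

(* [det corner] times the entries of the Schur complement of [corner]. *)
Definition schur i j : A :=
  \det corner * x i j - \sum_(a < k) (\sum_(b < k) x i b * \adj corner b a) * x a j.

Lemma schur_row i j : (i < k)%N -> schur i j = 0.
Proof.
move=> ik; apply/eqP; rewrite subr_eq0; apply/eqP.
have E (a : 'I_k) : \sum_(b < k) x i b * \adj corner b a = (\det corner)%:M (Ordinal ik) a.
  by rewrite -mul_mx_adj [RHS]mxE; apply: eq_bigr => b _; rewrite [in RHS]mxE.
under eq_bigr do rewrite E mxE.
rewrite (bigD1 (Ordinal ik)) //= eqxx big1 ?addr0 // => a ai.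
by rewrite eq_sym (negbTE ai) mul0r.
Qed.

Lemma schur_col i j : (j < k)%N -> schur i j = 0.
Proof.
move=> jk; apply/eqP; rewrite subr_eq0; apply/eqP.
have E (b : 'I_k) : \sum_(a < k) \adj corner b a * x a j = (\det corner)%:M b (Ordinal jk).
  by rewrite -mul_adj_mx [RHS]mxE; apply: eq_bigr => a _; rewrite [corner _ _]mxE.
under eq_bigr do rewrite mulr_suml.
rewrite exchange_big /=.
under eq_bigr do under eq_bigr do rewrite -mulrA.
under eq_bigr do rewrite -mulr_sumr E mxE.
rewrite (bigD1 (Ordinal jk)) //= eqxx big1 ?addr0 1?mulrC // => b bj.
by rewrite (negbTE bj) mulr0.
Qed.

(** Multiplied by [\det corner], the submatrix is a product factoring through dimension [k] plus a
    matrix of entries of [schur], so [det_low_rank_mem] applies; scaling [t] rows accounts for the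
    power [t]. *)
Lemma det_minor_schur (Q : ideal A) t (f g : 'I_t -> nat) :
  (forall i j, Q (schur i j)) ->
  (Q ^+ (t - k))%R (\det corner ^+ t * \det (\matrix_(i, j) x (f i) (g j))).
Proof.
move=> QW; rewrite -detZ.
rewrite (_ : _ *: _ = (\matrix_(i, a) \sum_(b < k) x (f i) b * \adj corner b a) *m
  (\matrix_(a, j) x a (g j)) + \matrix_(i, j) schur (f i) (g j)).
  by apply: det_low_rank_mem => i j; rewrite mxE.
apply/matrixP => i j; rewrite !mxE /schur addrC.
under [X in _ + X]eq_bigr do rewrite !mxE.
by rewrite subrK.
Qed.

End Corner.

Lemma mconst_hom (R : comNzRingType) k :
  exists phi : {rmorphism R -> MP R k}, phi =1 @mconst R k.
Proof.
elim: k => [|k [phi IH]]; first by exists idfun.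
exists ((@polyC (MP R k)) \o phi : {rmorphism R -> {poly MP R k}}) => c.
by rewrite /= IH.
Qed.

Lemma polyX_exp_lreg (F : fieldType) n : GRing.lreg ('X ^+ n : {poly F}).
Proof. by apply: mulfI; rewrite expf_neq0 ?polyX_eq0. Qed.

(** With [q = p ^ e], Frobenius turns $d \equiv s^k$ modulo the variables into $d^q \equiv s^{kq}$
    modulo their [q]-th powers. A power of [s] is a regular constant and can be cancelled. *)
Lemma unit_modulo_vars (F : fieldType) p e K k (d y : MP {poly F} K) M :
  p \in [pchar F] ->
  varpow_ideal {poly F} 1 K (d - mconst K 'X ^+ k) ->
  varpow_ideal {poly F} (p ^ e) K (d ^+ M * y) -> varpow_ideal {poly F} (p ^ e) K y.
Proof.
move=> pF dX dy; have pC : p \in [pchar MP {poly F} K].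
  exact/pchar_MP/(rmorph_pchar (@polyC F)).
set L := varpow_ideal _ (p ^ e) K in dy *; set s := mconst K 'X in dX.
have Lq : L (d ^+ (p ^ e) - s ^+ k ^+ (p ^ e)).
  rewrite -{1}(subrK (s ^+ k) d) (frobD e pC) addrK.
  apply: (ideal_gen_frob pC) dX => _ [i [iK ->]]; apply: mem_ideal_gen.
  by exists i; rewrite expr1.
have LM : L (d ^+ (p ^ e) ^+ M - s ^+ k ^+ (p ^ e) ^+ M).
  by rewrite subrXX; apply: ideal_memMr.
apply: (@varpow_regular _ _ _ ('X ^+ (k * (p ^ e) * M)) _ (@polyX_exp_lreg F _)).
rewrite mconstX !exprM -/s; apply: (@ideal_subr _ L _ (d ^+ (p ^ e) ^+ M * y)).
  by rewrite -mulrBl -opprB mulNr; apply/idealN/ideal_memMr.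
rewrite -exprM mulnC exprM -(prednK (_ : 0 < p ^ e)%N).
  by rewrite exprS mulrAC; apply: ideal_memMr.
by rewrite expn_gt0 prime_gt0 ?(pcharf_prime pF).
Qed.

Lemma varpow_frob_pow (F : fieldType) q m n :
  ideal_sub (varpow_ideal F q (m * n)) (frob_pow (max_ideal F m n) q).
Proof.
apply: ideal_gen_min; first exact: ideal_gen_is_ideal.
move=> _ [i [imn ->]]; apply: mem_ideal_gen; exists (mvar F (m * n) i); split=> //.
by apply: mem_ideal_gen; exists i.
Qed.

Lemma frob_pow_varpow (F : fieldType) p e m n : p \in [pchar F] ->
  ideal_sub (frob_pow (max_ideal F m n) (p ^ e)) (varpow_ideal F (p ^ e) (m * n)).
Proof.
move=> pF; apply: ideal_gen_min; first exact: idealP.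
move=> _ [a [Ma ->]]; apply: (ideal_gen_frob (pchar_MP _ pF)) Ma => _ [i [imn ->]].
by apply: mem_ideal_gen; exists i.
Qed.

(** * Powers of the determinantal ideal inside the Frobenius power *)

Section Upper.
Variables (F : fieldType) (p e m n t k : nat).
Hypotheses (pF : p \in [pchar F]) (kt : (k < t)%N) (tm : (t <= m)%N) (mn : (m <= n)%N).

Local Notation K := (m * n)%N.
Local Notation C := (MP {poly F} K).
Local Notation L := (varpow_ideal {poly F} (p ^ e) K).

(* The generic matrix translated by s times the idempotent diagonal matrix of rank k. *)
Let x (i j : nat) : C :=
  gx {poly F} m n i j + (if (i == j) && (i < k)%N then mconst K 'X else 0).

Local Notation d := (\det (corner x k)).

Lemma gx_vars i j : varpow_ideal {poly F} 1 K (gx {poly F} m n i j).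
Proof.
rewrite /gx; case: ifP => [/andP[im jn]|_]; last exact: ideal0.
apply: mem_ideal_gen; exists (i * n + j)%N; split; last by rewrite expr1.
by nia.
Qed.

Lemma corner_congr : varpow_ideal {poly F} 1 K (d - mconst K 'X ^+ k).
Proof.
rewrite -(det_scalar k); apply: det_congr => i j; rewrite !mxE /x ltn_ord andbT.
have -> : (i == j :> nat) = (i == j) by [].
case: eqP => _; rewrite ?mulr0n ?subr0 ?addr0 ?mulr1n ?addrK; exact: gx_vars.
Qed.

Let w (u : 'I_(m - k) * 'I_(n - k)) : C := schur x k (k + u.1) (k + u.2).

(** Entries of [schur] in the first [k] rows or columns vanish, as do those outside the matrix; only
    the $(m-k)(n-k)$ elements [w u] remain. *)
Lemma schur_mem i j : gen_ideal (fun y => exists u, y = w u) (schur x k i j).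
Proof.
have [ik|ki] := ltnP i k; first by rewrite schur_row //; apply: ideal0.
have [jk|kj] := ltnP j k; first by rewrite schur_col //; apply: ideal0.
have x0 i' j' : ~~ ((i' < m) && (j' < n))%N -> x i' j' = 0.
  rewrite /x /gx => /negbTE h; rewrite h add0r ifF //; lia.
have [im|mi] := ltnP i m; last first.
  rewrite /schur x0 1?big1 => [|a _|]; rewrite ?mulr0 ?subrr; first exact: ideal0.
    by rewrite big1 ?mul0r // => b _; rewrite x0 ?mul0r //; lia.
  by lia.
have [jn|nj] := ltnP j n; last first.
  rewrite /schur x0 1?big1 => [|a _|]; rewrite ?mulr0 ?subrr; first exact: ideal0.
    by rewrite x0 ?mulr0 //; lia.
  by lia.
have hi : (i - k < m - k)%N by lia.
have hj : (j - k < n - k)%N by lia.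
by apply: mem_ideal_gen; exists (Ordinal hi, Ordinal hj); rewrite /w /= !subnKC.
Qed.

(** Every term of [w u] contains an entry from a row of index at least [k], which is an untranslated
    variable; then Frobenius applies. *)
Lemma schur_frob u : L (w u ^+ (p ^ e)).
Proof.
have pC : p \in [pchar C] by exact/pchar_MP/(rmorph_pchar (@polyC F)).
have : varpow_ideal {poly F} 1 K (w u).
  have xk i j : (k <= i)%N -> x i j = gx {poly F} m n i j.
    by move=> ki; rewrite /x ltnNge ki andbF addr0.
  apply: idealB; first by apply: ideal_memMl; rewrite xk ?leq_addr //; apply: gx_vars.
  apply: ideal_sum => a _; apply: ideal_memMr; apply: ideal_sum => b _; apply: ideal_memMr.
  by rewrite xk ?leq_addr //; apply: gx_vars.
apply: (ideal_gen_frob pC) => _ [i [iK ->]]; rewrite expr1.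
by apply: mem_ideal_gen; exists i.
Qed.

Lemma minors_pow_sub r : ((p ^ e).-1 * ((m - k) * (n - k)) < r * (t - k))%N ->
  ideal_sub (ideal_pow (minors_ideal F m n t) r) (frob_pow (max_ideal F m n) (p ^ e)).
Proof.
move=> hr; set I := minors_ideal F m n t.
have [phi0 phi0E] := mconst_hom {poly F} K; have [phi1 phi1E] := mconst_hom F K.
(* [psi] is the translation: variable [v] sits in row [v %/ n] and column [v %% n]. Below, [sg] puts
   [s = 0] and is a left inverse of [psi]. *)
have [psi [psiv psic]] := MP_hom (phi0 \o (@polyC F))
  (fun v => x (v %/ n) (v %% n)) K.
have [sg [sgv sgc]] := MP_hom (phi1 \o (horner_eval (0 : F))) (mvar F K) K.
have sgpsi u : sg (psi u) = u.
  apply: (@MP_hom_eq F (MP F K) K (sg \o psi) idfun) => [v vK|c] /=.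
    have n0 : (0 < n)%N by case: (n) vK; rewrite ?muln0.
    rewrite psiv // /x /gx ltn_divLR // vK ltn_mod n0 /= -divn_eq rmorphD sgv //.
    case: ifP => _; last by rewrite rmorph0 addr0.
    by rewrite sgc /= horner_evalE hornerX rmorph0 addr0.
  by rewrite psic /= phi0E sgc /= horner_evalE hornerC phi1E.
have psix i j : (i < m)%N -> (j < n)%N -> psi (gx F m n i j) = x i j.
  move=> im jn; rewrite {1}/gx im jn /= psiv ?divnMDl ?modnMDl ?divn_small ?modn_small ?addn0 //.
    by lia.
  by nia.
have T_ideal : is_ideal (fun u => L (psi u)).
  split=> [|a b|a b]; rewrite ?rmorph0 ?rmorphD ?rmorphM; first exact: ideal0.
    exact: idealD.
  exact: ideal_memMl.
suff HT : ideal_sub (ideal_pow I r) (Ideal T_ideal).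
  move=> u /HT /= Lu; rewrite -[u]sgpsi.
  apply: varpow_frob_pow; move: (psi u) Lu.
  have h : is_ideal (fun y => varpow_ideal F (p ^ e) K (sg y)).
    split=> [|a b|a b]; rewrite ?rmorph0 ?rmorphD ?rmorphM; first exact: ideal0.
      exact: idealD.
    exact: ideal_memMl.
  apply: (ideal_gen_min h) => _ [i [iK ->]]; rewrite rmorphXn sgv //.
  by apply: mem_ideal_gen; exists i.
have -> : I = minorsI F m n t by [].
rewrite expIE; apply: expI_gen_sub => s sE /=; rewrite rmorph_prod.
(* Each of the [r] minors receives a factor [d ^+ t], which puts it into the [(t - k)]-th power of
   the ideal of the [w u]. *)
apply: (unit_modulo_vars (M := (t * r)%N) pF corner_congr).
have -> : d ^+ (t * r) * \prod_i psi (s i) = \prod_(i < r) (d ^+ t * psi (s i)).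
  by rewrite big_split /= prodr_const card_ord exprM.
have := @ideal_pigeonhole C _ w L (p ^ e) (r * (t - k)) _ schur_frob.
rewrite card_prod !card_ord mulnC; apply.
- by rewrite expn_gt0 prime_gt0 ?(pcharf_prime pF).
- exact: hr.
rewrite (mulnC r) exprM -[X in _ ^+ X](card_ord r) -prodr_const; apply: mem_prodI => i _.
have [f [g [_ [_ ->]]]] := sE i.
rewrite -det_map_mx (_ : map_mx _ _ = \matrix_(i, j) x (f i) (g j)).
  by apply: det_minor_schur; apply: schur_mem.
by apply/matrixP => a b; rewrite [LHS]mxE [in LHS]mxE -gxE psix ?[RHS]mxE.
Qed.

End Upper.

(** * Lower bound *)

(** Expansion along the last row: the bottom right entry has the largest index in the block, and its
    cofactor is the minor of size [s - 1]. *)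
Lemma lead_mon_minor (R : comNzRingType) m n r c s : (r + s <= m)%N -> (c + s <= n)%N ->
  lead_mon (minor (gx R m n) r c s) (fun v => \sum_(i < s) (v == (r + i) * n + (c + i)))%N.
Proof.
elim: s => [|s IH] rs cs.
  rewrite /minor det_mx00; apply: lead_mon_ext (lead_mon1 _ _) => v _.
  by rewrite big_ord0.
have {}IH := IH (leq_trans (leq_add (leqnn r) (leqnSn s)) rs)
  (leq_trans (leq_add (leqnn c) (leqnSn s)) cs).
set v0 := ((r + s) * n + (c + s))%N.
have v0K : (v0 < m * n)%N by rewrite /v0; nia.
have entry i j : (i <= s)%N -> (j <= s)%N -> (i < s)%N || (j < s)%N ->
    below v0 (gx R m n (r + i) (c + j)).
  move=> is_ js ij; rewrite /gx; case: ifP => _; last exact: below0.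
  by apply: below_mvar; rewrite /v0; case/orP: ij => ij; nia.
rewrite {1}/minor (expand_det_row _ ord_max) (bigD1 ord_max) //=.
have -> : cofactor (\matrix_(i < s.+1, j < s.+1) gx R m n (r + i) (c + j)) ord_max ord_max
    = minor (gx R m n) r c s.
  rewrite /cofactor /= addnn -signr_odd odd_double expr0 mul1r; congr (\det _).
  by apply/matrixP => i j; rewrite !mxE !lift_max.
have -> : (\matrix_(i < s.+1, j < s.+1) gx R m n (r + i) (c + j)) ord_max ord_max
    = mvar R (m * n) v0.
  rewrite mxE /gx /= !ifT //; lia.
have IH' := lead_mon_mvarMD v0K _ _ IH.
apply: lead_mon_ext (IH' _ _ _) => [v _||].
- by rewrite big_ord_recr.
- apply: below_det => i j; rewrite mxE; apply: entry; rewrite ?(ltnW (ltn_ord _)) //.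
  by rewrite ltn_ord.
- apply: below_sum => j jmax; apply: belowM.
    rewrite mxE; apply: entry => //=; first by rewrite -ltnS.
    apply/orP; right; rewrite ltn_neqAle -ltnS ltn_ord andbT.
    by apply: contraNneq jmax => js; apply/eqP/val_inj.
  apply: belowM; first exact: below_sign.
  apply: below_det => i j'; rewrite !mxE !lift_max.
  by apply: entry; rewrite ?(ltnW (ltn_ord _)) ?ltn_ord // -ltnS.
Qed.

Lemma sum_bool_le1 (J : finType) (P : pred J) (b : bool) :
  (forall i j, P i -> P j -> i = j) -> (forall i, P i -> b) -> (\sum_i P i <= b)%N.
Proof.
move=> Puniq Pb; have [/existsP[i Pi]|/existsPn none] := boolP [exists i, P i].
  rewrite (bigD1 i) //= Pi (Pb i Pi) big1 // => j ji.
  by case Pj: (P j) => //; rewrite (Puniq _ _ Pj Pi) eqxx in ji.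
by rewrite big1 // => i _; rewrite (negbTE (none i)).
Qed.

(** * The product of the diagonal minors and its weights *)

Section Diagonals.
Variables (F : fieldType) (m n : nat).
Hypothesis mn : (m <= n)%N.

(** The length of the diagonal $j-i=l-m$. The empty diagonals [l = 0] and [l = m + n] are included;
    the first can serve as the diagonal of size [k] when [k = 0]. *)
Definition diag_size l := minn (minn l m) (m + n - l).

(* The minor whose main diagonal is the whole diagonal j - i = l - m of the matrix. *)
Definition diag_minor l : polyRing F m n := minor (gx F m n) (m - l) (l - m) (diag_size l).

Definition diag_prod : polyRing F m n := \prod_(l < (m + n).+1) diag_minor l.

(** Each entry of the matrix lies on a single diagonal, [l0] in the proof, and occurs there once. *)
Lemma lead_mon_diag_prod : exists2 e, lead_mon diag_prod e &
  forall v, (v < m * n)%N -> (e v <= 1)%N.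
Proof.
exists (fun v => \sum_(l < (m + n).+1) \sum_(i < diag_size l)
    (v == (m - l + i) * n + (l - m + i)))%N.
  apply: lead_mon_prod => l; apply: lead_mon_minor; have := ltn_ord l; rewrite /diag_size; lia.
move=> v vK; pose l0 := (v %% n + m - v %/ n)%N.
have key (l : 'I_(m + n).+1) (i : 'I_(diag_size l)) :
    v == ((m - l + i) * n + (l - m + i))%N -> l = l0 :> nat /\ i = (v %/ n - (m - l))%N :> nat.
  move=> /eqP vE; have lm := ltn_ord l.
  have il : (i < minn (minn l m) (m + n - l))%N := ltn_ord i.
  have cn : (l - m + i < n)%N by lia.
  rewrite /l0 vE divnMDl ?modnMDl ?divn_small ?modn_small //; last by lia.
  by split; lia.
apply: (@leq_trans (\sum_(l < (m + n).+1) (nat_of_ord l == l0))%N).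
  apply: leq_sum => l _; apply: sum_bool_le1 => [i j Pi Pj|i /key[/eqP]]; last by [].
  apply: val_inj => /=; have [_ ->] := key _ _ Pi; by have [_ ->] := key _ _ Pj.
apply: (@sum_bool_le1 _ _ true) => // i j /eqP il /eqP jl.
by apply: val_inj; rewrite /= il.
Qed.

Lemma diag_prod_notin q j : (j < q)%N -> ~ varpow_ideal F q (m * n) (diag_prod ^+ j).
Proof.
move=> jq; have [e le e1] := lead_mon_diag_prod.
apply: (lead_mon_notin (lead_monX j le)) => i iK; apply: leq_ltn_trans jq.
by rewrite -{2}(muln1 j) leq_mul2l e1 ?orbT.
Qed.

Variables (t k : nat).
Hypotheses (kt : (k < t)%N) (tm : (t <= m)%N).
Local Notation h := ((m - k) * (n - k))%N.
Local Notation tau := (t - k)%N.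
Local Notation I := (minorsI F m n t).
(** The weight of the diagonal of size [k], chosen so that the weights add up to [h]. *)
Variable theta : nat.
Hypothesis thetaE : (theta + tau * (m + n - k.*2 - 1) = h)%N.

(* Weights supported on the diagonals below (resp. above) the middle ones, which are shared. *)
Definition low_weight l : nat :=
  if (n < l)%N then 0%N else if (m <= l)%N then tau else
  if (k < l)%N then tau.*2 else if l == k then theta else 0%N.
Definition high_weight l : nat := low_weight (m + n - l).

(** The weights sit on one diagonal of size [k], one of each size strictly between [k] and [m], and
    the [n - m + 1] diagonals of size [m]. *)
Lemma sum_low_weight (g : nat -> nat) :
  (\sum_(l < (m + n).+1) low_weight l * g (diag_size l) =
   theta * g k + (\sum_(k.+1 <= l < m) tau.*2 * g l + (n - m).+1 * (tau * g m)))%N.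
Proof.
rewrite -(big_mkord xpredT (fun l => low_weight l * g (diag_size l))%N).
rewrite (big_cat_nat (n := k)) //=; last by lia.
rewrite [X in (X + _)%N]big_nat_cond big1 ?add0n; last first.
  by move=> l; rewrite andbT /low_weight => lk; rewrite !ifF //; lia.
rewrite big_ltn; last by lia.
congr (_ + _)%N.
  rewrite /low_weight ltnn eqxx /= !ifF; [|lia..].
  by congr (_ * g _)%N; rewrite /diag_size; lia.
rewrite (big_cat_nat (n := m)) /=; [|lia..].
congr (_ + _)%N.
  apply: eq_big_nat => l lkm; rewrite /low_weight.
  have [-> -> ->] : [/\ (n < l)%N = false, (m <= l)%N = false & (k < l)%N] by split; lia.
  by congr (_ * g _)%N; rewrite /diag_size; lia.
rewrite (big_cat_nat (n := n.+1)) /=; [|lia..].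
rewrite [X in (_ + X)%N]big_nat_cond [X in (_ + X)%N]big1 ?addn0; last first.
  by move=> l; rewrite andbT /low_weight => lk; rewrite ifT //; lia.
have -> : (\sum_(m <= l < n.+1) low_weight l * g (diag_size l) =
    \sum_(m <= l < n.+1) tau * g m)%N.
  apply: eq_big_nat => l lmn; rewrite /low_weight.
  have [-> ->] : (n < l)%N = false /\ (m <= l)%N by split; lia.
  by congr (_ * g _)%N; rewrite /diag_size; lia.
by rewrite sum_nat_const_nat; congr (_ * _)%N; lia.
Qed.

Lemma sum_double_interval a b : (a <= b)%N -> (\sum_(a <= l < b) l.*2 = (b - a) * (a + b - 1))%N.
Proof.
move=> /subnKC <-; elim: (b - a)%N => [|c IH]; first by rewrite addn0 big_geq ?subnn.
rewrite addnS big_nat_recr ?leq_addr //= IH -addnS !addKn; case: c {IH} => [|c]; first by lia.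
have -> : (a + (a + c.+2) - 1 = a.*2 + c.+1)%N by lia.
have -> : (a + (a + c.+1) - 1 = a.*2 + c)%N by lia.
nia.
Qed.

Lemma sum_low_weight1 : (\sum_(l < (m + n).+1) low_weight l = h)%N.
Proof.
transitivity (\sum_(l < (m + n).+1) low_weight l * 1)%N.
  by apply: eq_bigr => l _; rewrite muln1.
rewrite (sum_low_weight (fun=> 1%N)) sum_nat_const_nat -thetaE !muln1; nia.
Qed.

(** The balance condition of [integral_deg_balance]: the weighted average size is exactly [t]. *)
Lemma sum_low_weight_size : (\sum_(l < (m + n).+1) low_weight l * diag_size l = t * h)%N.
Proof.
rewrite (sum_low_weight id).
have -> : (\sum_(k.+1 <= l < m) tau.*2 * l = tau * ((m - k.+1) * (k.+1 + m - 1)))%N.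
  rewrite -sum_double_interval; last by lia.
  by rewrite big_distrr; apply: eq_bigr => l _ /=; lia.
(* These substitutions remove truncated subtraction and leave a polynomial identity. *)
have [a ma] : exists a, m = (k + a.+1)%N by exists (m - k.+1)%N; lia.
have [b nb] : exists b, n = (m + b)%N by exists (n - m)%N; lia.
have [c tc] : exists c, t = (k + c)%N by exists (t - k)%N; lia.
move: thetaE; rewrite nb ma tc /=.
have -> : (k + c - k = c)%N by lia.
have -> : (k + a.+1 + (k + a.+1 + b) - k.*2 - 1 = a.*2.+1 + b)%N by lia.
have -> : (k + a.+1 - k = a.+1)%N by lia.
have -> : (k + a.+1 + b - k = a.+1 + b)%N by lia.
have -> : (k + a.+1 + b - (k + a.+1) = b)%N by lia.
have -> : (k + a.+1 - k.+1 = a)%N by lia.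
have -> : (k.+1 + (k + a.+1) - 1 = k.*2 + a.+1)%N by lia.
move=> E; rewrite mulnDl -E; nia.
Qed.

Lemma sum_rev (f : nat -> nat) :
  (\sum_(l < (m + n).+1) f (m + n - l) = \sum_(l < (m + n).+1) f l)%N.
Proof.
rewrite (reindex_inj rev_ord_inj) /=; apply: eq_bigr => l _; congr f.
by have := ltn_ord l; lia.
Qed.

(** For [l <= n] the diagonal ends in the last row of the matrix, so any two of these minors form a
    bottom-aligned pair. *)
Lemma low_integral :
  integral_deg I (\prod_(l < (m + n).+1) diag_minor l ^+ low_weight l) h.
Proof.
rewrite -sum_low_weight1.
apply: (@integral_deg_balance _ _ _ (fun l : 'I__ => diag_size l) (fun l : 'I__ => low_weight l)
  (fun l : 'I__ => diag_minor l) t) => [i j Wi Wj st|j Wj st|].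
- have r0 (l : 'I_(m + n).+1) : (0 < low_weight l)%N -> (m - l = m - diag_size l)%N.
    by rewrite /low_weight /diag_size; case: ifP => // ln _; lia.
  have sm (l : 'I_(m + n).+1) : (diag_size l <= m)%N by rewrite /diag_size; lia.
  rewrite /diag_minor (r0 i) // (r0 j) //.
  have -> : (m - diag_size i = (m - diag_size j) + (diag_size j - diag_size i))%N.
    by have := sm j; lia.
  exact: (@minor_pair_bottom _ _ _ t (@minorsI_mem F m n t)).
- by rewrite /diag_minor st; apply: (@minor_integral _ _ _ t (@minorsI_mem F m n t)).
- by rewrite sum_low_weight_size sum_low_weight1.
Qed.

(** For [l >= m] the diagonal starts in row 0, so the pairs are top-aligned. *)
Lemma high_integral :
  integral_deg I (\prod_(l < (m + n).+1) diag_minor l ^+ high_weight l) h.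
Proof.
have sz (l : 'I_(m + n).+1) : diag_size (m + n - l) = diag_size l.
  by rewrite /diag_size; have := ltn_ord l; lia.
have E : (\sum_(l < (m + n).+1) high_weight l = h)%N by rewrite sum_rev sum_low_weight1.
rewrite -E.
apply: (@integral_deg_balance _ _ _ (fun l : 'I__ => diag_size l) (fun l : 'I__ => high_weight l)
  (fun l : 'I__ => diag_minor l) t) => [i j Wi Wj st|j Wj st|].
- have r0 (l : 'I_(m + n).+1) : (0 < high_weight l)%N -> (m - l = 0)%N.
    by rewrite /high_weight /low_weight; case: ifP => // ln _; lia.
  by rewrite /diag_minor (r0 i) // (r0 j) //; exact: (@minor_pair_top _ _ _ t (@minorsI_mem F m n t)).
- by rewrite /diag_minor st; apply: (@minor_integral _ _ _ t (@minorsI_mem F m n t)).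
- rewrite E -sum_low_weight_size -(sum_rev (fun l => low_weight l * diag_size l)%N).
  by apply: eq_bigr => l _; rewrite sz.
Qed.

Hypothesis theta2 : (0 < k)%N -> (theta <= tau.*2)%N.

(** Both weights equal [tau] on the diagonals from [m] to [n], and at most one is nonzero elsewhere.
    So nonempty diagonals carry at most [tau.*2] in all, and the leftover factor is harmless. *)
Lemma diag_prod_integral : integral_deg I (diag_prod ^+ tau.*2) h.*2.
Proof.
rewrite -(addnn h).
have -> : diag_prod ^+ tau.*2 =
   (\prod_(l < (m + n).+1) diag_minor l ^+ low_weight l *
    \prod_(l < (m + n).+1) diag_minor l ^+ high_weight l) *
   \prod_(l < (m + n).+1) diag_minor l ^+ (tau.*2 - (low_weight l + high_weight l)).
  rewrite -prodrXl -!big_split; apply: eq_bigr => l _ /=; rewrite -!exprD.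
  (* An empty diagonal contributes 1, whatever its weight; this covers [theta] when [k = 0]. *)
  have [s0|s0] := posnP (diag_size l); first by rewrite /diag_minor s0 /minor det_mx00 !expr1n.
  rewrite subnKC // /low_weight /high_weight /low_weight.
  by move: s0 theta2; rewrite /diag_size; do !case: ifP; lia.
apply: integral_deg_mulr; apply: integral_degM; [exact: low_integral | exact: high_integral].
Qed.

End Diagonals.

(** * The limit *)

Lemma fpt_formula_argmin m n t : (0 < t)%N -> (t <= m)%N -> (m <= n)%N ->
  exists k, [/\ (k < t)%N,
    fpt_formula m n t = ((m - k) * (n - k))%:R / (t - k)%:R &
    forall i, (i < t)%N ->
      ((m - k) * (n - k) * (t - i) <= (m - i) * (n - i) * (t - k))%N].
Proof.
move=> t0 tm mn.
pose f (i : 'I_t) : rat := ((m - i) * (n - i))%:R / (t - i)%:R.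
have [k _ kmin] := @Order.TotalTheory.arg_minP _ _ _ (Ordinal t0) predT f isT.
exists k; split=> [//||i it].
  apply/eqP; rewrite eq_le; apply/andP; split; first exact: Order.TotalTheory.bigmin_le.
  apply: le_bigmin => [|i _]; last exact: kmin.
  (* The default value of the minimum is its term at 0. *)
  by have := kmin (Ordinal t0) isT; rewrite {2}/f /= !subn0.
have := kmin (Ordinal it) isT; rewrite /f /=.
rewrite ler_pdivrMr ?ltr0n ?subn_gt0 // mulrAC ler_pdivlMr ?ltr0n ?subn_gt0 //.
by rewrite -!natrM ler_nat.
Qed.

(* Optimality of [k] against its two neighbours bounds the multiplicity with
   which the diagonals of length [k] have to be used. *)
Lemma argmin_theta m n t k : (k < t)%N -> (t <= m)%N -> (m <= n)%N ->
  (forall i, (i < t)%N -> ((m - k) * (n - k) * (t - i) <= (m - i) * (n - i) * (t - k))%N) ->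
  exists2 theta, (theta + (t - k) * (m + n - k.*2 - 1) = (m - k) * (n - k))%N &
    ((0 < k)%N -> (theta <= (t - k).*2)%N).
Proof.
move=> kt tm mn opt.
have [a ma] : exists a, m = (k + a.+1)%N by exists (m - k.+1)%N; lia.
have [b nb] : exists b, n = (k + b.+1)%N by exists (n - k.+1)%N; lia.
have [c tc] : exists c, t = (k + c.+1)%N by exists (t - k.+1)%N; lia.
have Em : (m - k = a.+1)%N by lia.
have En : (n - k = b.+1)%N by lia.
have Et : (t - k = c.+1)%N by lia.
have Es : (m + n - k.*2 - 1 = (a + b).+1)%N by lia.
rewrite Em En Et Es.
(* Nonnegativity of [theta] comes from the neighbour [k.+1], or directly when [k.+1 = t]; the upper
   bound below comes from [k.-1]. *)
have le1 : (c.+1 * (a + b).+1 <= a.+1 * b.+1)%N.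
  case: (posnP c) => [->|c0]; first by nia.
  have := opt k.+1 _; rewrite Em En Et.
  have -> : (t - k.+1 = c)%N by lia.
  have -> : (m - k.+1 = a)%N by lia.
  have -> : (n - k.+1 = b)%N by lia.
  move=> /(_ _) H; have {}H := H ltac:(lia); nia.
exists (a.+1 * b.+1 - c.+1 * (a + b).+1)%N; first by rewrite subnK.
move=> k0; have := opt k.-1 _; rewrite Em En Et.
have -> : (t - k.-1 = c.+2)%N by lia.
have -> : (m - k.-1 = a.+2)%N by lia.
have -> : (n - k.-1 = b.+2)%N by lia.
move=> H; have {}H := H ltac:(lia); nia.
Qed.

Lemma exists_is_nu (A : comNzRingType) (I J : A -> Prop) B :
  ~ J 1 -> (forall r, (B < r)%N -> ideal_sub (ideal_pow I r) J) -> exists v, is_nu I J v.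
Proof.
move=> J1 IB; pose P r := `[< ~ ideal_sub (ideal_pow I r) J >].
have exP : exists r, P r by exists 0%N; apply/asboolP => /(_ 1 Logic.I).
have PB r : P r -> (r <= B)%N.
  by move=> /asboolP nIJ; rewrite leqNgt; apply/negP => /IB.
have [v /asboolP vP vmax] := ex_maxnP exP PB.
by exists v; split=> // r rP; apply/vmax/asboolP.
Qed.

Lemma rat_cvg_of_bounds (u : nat -> nat) p (h tau D : nat) :
  (1 < p)%N -> (0 < tau)%N ->
  (forall e, (u e * tau <= h * p ^ e)%N /\ (h * p ^ e <= u e * tau + D)%N) ->
  rat_cvg (fun e => (u e)%:R / (p ^ e)%:R) (h%:R / tau%:R).
Proof.
move=> p1 tau0 bnd eps eps0; exists (Num.bound (D%:R / eps)) => e Ne.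
have q0 : 0 < (p ^ e)%:R :> rat by rewrite ltr0n expn_gt0 (ltnW p1).
have t0 : 1 <= tau%:R :> rat by rewrite ler1n.
have tp : 0 < tau%:R :> rat by rewrite ltr0n.
have Dq : D%:R < eps * (p ^ e)%:R.
  rewrite mulrC -ltr_pdivrMr //.
  apply: lt_le_trans (archi_boundP _) _; first by rewrite divr_ge0 ?ler0n ?ltW.
  rewrite ler_nat (leq_trans Ne) // ltnW // ltn_expl //.
have [b1 b2] := bnd e; rewrite -(ler_nat rat) !natrM in b1.
rewrite -(ler_nat rat) natrD !natrM in b2.
have -> : (u e)%:R / (p ^ e)%:R - h%:R / tau%:R =
    ((u e)%:R * tau%:R - h%:R * (p ^ e)%:R) / (tau%:R * (p ^ e)%:R) :> rat.
  by field; rewrite !lt0r_neq0.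
rewrite normrM normfV [X in _ / X]ger0_norm ?mulr_ge0 ?ltW //.
rewrite ltr_pdivrMr ?mulr_gt0 //.
rewrite ler0_norm ?subr_le0 // opprB.
apply: (@le_lt_trans _ _ D%:R); first by lra.
apply: (lt_le_trans Dq); rewrite mulrCA ler_peMl //.
by rewrite mulr_ge0 ?ltW.
Qed.

Theorem theorem1p1 (F : fieldType) (p m n t : nat)
  (hp : p \in [pchar F]) (ht : (0 < t)%N) (htm : (t <= m)%N) (hmn : (m <= n)%N) :
  exists nu : nat -> nat,
    (forall e, is_nu (minors_ideal F m n t) (frob_pow (max_ideal F m n) (p ^ e)) (nu e)) /\
    rat_cvg (fun e => (nu e)%:R / (p ^ e)%:R) (fpt_formula m n t).
Proof.
have p1 := prime_gt1 (pcharf_prime hp).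
have q0 e : (0 < p ^ e)%N by rewrite expn_gt0 (ltnW p1).
have [k [kt -> opt]] := fpt_formula_argmin ht htm hmn.
have [theta thE th2] := argmin_theta kt htm hmn opt.
set h := ((m - k) * (n - k))%N in thE *; set tau := (t - k)%N in thE th2 *.
have tau0 : (0 < tau)%N by rewrite subn_gt0.
have upper e r := @minors_pow_sub F p e m n t k hp kt htm hmn r.
have out e x : ~ varpow_ideal F (p ^ e) (m * n) x -> ~ frob_pow (max_ideal F m n) (p ^ e) x.
  by move=> nx /(frob_pow_varpow hp).
have /choice[nu nuP] : forall e, exists v,
    is_nu (minors_ideal F m n t) (frob_pow (max_ideal F m n) (p ^ e)) v.
  move=> e; apply: (@exists_is_nu _ _ _ ((p ^ e).-1 * h)) => [|r hr].
    (* The element 1 is treated as the zeroth power of [diag_prod]. *)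
    by apply: out; have := @diag_prod_notin F m n hmn (p ^ e) 0; rewrite expr0; apply.
  apply: upper; apply: leq_trans hr _; rewrite -/tau; nia.
exists nu; split=> //.
have [N N0 HN] := @diag_prod_integral F m n hmn t k kt htm theta thE th2.
set D := (tau.*2 * N)%N.
apply: (@rat_cvg_of_bounds nu p h tau (h * D) p1 tau0) => e.
have [nu1 nu2] := nuP e; split.
  rewrite leqNgt; apply/negP => lt_nu; apply: nu1; apply: upper; rewrite -/h -/tau.
  apply: leq_ltn_trans lt_nu; rewrite mulnC leq_mul2l leq_pred orbT //.
have D0 : (0 < D)%N by rewrite muln_gt0 double_gt0 tau0.
(* The largest [d] with [D * d < p ^ e]: the power [D * d] of [diag_prod] avoids the Frobenius power
   but lies in the power [N * h.*2 * d] of the minors ideal. *)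
set d := ((p ^ e).-1 %/ D)%N.
have Dd : (D * d < p ^ e)%N by rewrite -[X in (_ < X)%N](prednK (q0 e)) ltnS mulnC leq_trunc_div.
have qD : (p ^ e <= D * d.+1)%N.
  by rewrite -[X in (X <= _)%N](prednK (q0 e)) mulnC ltn_ceil.
have le_nu : (N * h.*2 * d <= nu e)%N.
  apply: nu2 => sub; apply: (out e _ (@diag_prod_notin F m n hmn (p ^ e) (D * d) Dd)).
  apply: sub.
  rewrite (_ : minors_ideal F m n t = minorsI F m n t) // expIE.
  have := mem_expI d HN; rewrite -!exprM -/tau -/h; by rewrite -(mulnA tau.*2).
(* The left side is [h * D * d], which falls short of [h * p ^ e] by at most [h * D], independently
   of [e]. *)
have : (N * h.*2 * d * tau <= nu e * tau)%N by rewrite leq_mul2r le_nu orbT.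
have : (h * p ^ e <= h * (D * d.+1))%N by rewrite leq_mul2l qD orbT.
rewrite /D; nia.
Qed.
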